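(* In the abelian case, $$\mathcal M_{\Delta(1)}(t)=\prod_{\gamma\in\Delta(1)}\frac{1-t^{\mathrm{ht}(\gamma)+1}}{1-t^{\mathrm{ht}(\gamma)}}.$$
   Context: Let $\mathfrak g$ be a complex simple Lie algebra with root system $\Delta$, positive roots $\Delta^+$, simple roots $\Pi$, highest root $\theta$. For $\gamma\in\Delta$, $[\gamma:\alpha]$ is the coefficient of $\alpha\in\Pi$ in $\gamma$ and $\mathrm{ht}(\gamma)=\sum_{\alpha\in\Pi}[\gamma:\alpha]$. Abelian case: fix $\alpha_i\in\Pi$ with $[\theta:\alpha_i]=1$ and let $\Delta(1)=\{\gamma\in\Delta:[\gamma:\alpha_i]=1\}$, partially ordered by $\mu\preccurlyeq\gamma$ iff $\gamma-\mu$ is a nonnegative integer combination of $\Pi\setminus\{\alpha_i\}$. For a finite poset $\mathcal P$, $\mathcal M_{\mathcal P}(t)=\sum_I t^{\#I}$, summed over all upper ideals $I$ of $\mathcal P$ (subsets closed upward, including $\varnothing$ and $\mathcal P$). *)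

(* Defs.v *)
From HB Require Import structures.
From mathcomp Require Import all_boot all_order all_algebra.
From mathcomp Require Import finmap boolp reals complex.
Set Implicit Arguments.
Unset Strict Implicit.
Unset Printing Implicit Defensive.
Import Order.TTheory GRing.Theory Num.Theory.
Local Open Scope ring_scope.
Local Open Scope complex_scope.

Definition hdual (K : fieldType) (g : vectType K) (h : {vspace g}) : vectType K :=
  'Hom(subvs_of h, K^o).

Section LieAlgebra.
Variables (K : fieldType) (g : vectType K) (br : g -> g -> g).

Definition lie_bracket : Prop :=
  [/\ forall x, linear (br x),
      forall y, linear (br^~ y),
      forall x, br x x = 0
    & forall x y z, br x (br y z) + br y (br z x) + br z (br x y) = 0].

Definition lie_ideal (U : {vspace g}) : Prop :=
  forall x y, y \in U -> br x y \in U.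

Definition simple_lie : Prop :=
  (exists x y, br x y != 0) /\
  (forall U : {vspace g}, lie_ideal U -> U = 0%VS \/ U = fullv).

Definition ad_diagonalizable (y : g) : Prop :=
  exists2 b : seq g, basis_of fullv b &
    forall v, v \in b -> exists a : K, br y v = a *: v.

(* For a complex semisimple Lie algebra: an abelian subalgebra that is its own
   centralizer and acts on g by diagonalizable endomorphisms. *)
Definition cartan_subalgebra (h : {vspace g}) : Prop :=
  [/\ forall x y, x \in h -> y \in h -> br x y = 0,
      forall x, (forall y, y \in h -> br y x = 0) -> x \in h
    & forall y, y \in h -> ad_diagonalizable y].

Definition is_root (h : {vspace g}) (a : 'Hom(subvs_of h, K^o)) : Prop :=
  a != 0 /\
  exists2 x : g, x != 0 & forall y : subvs_of h, br (vsval y) x = a y *: x.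

End LieAlgebra.

Section Roots.
Variables (R : realType) (V : vectType R[i]) (Delta : {fset V}).
Variables (r : nat) (Pi : r.-tuple V).

Definition simple_roots : Prop :=
  [/\ {subset Pi <= Delta},
      free Pi
    & forall a, a \in Delta -> exists n : 'I_r -> nat,
        a = \sum_(j < r) Pi`_j *+ n j \/ a = - \sum_(j < r) Pi`_j *+ n j].

Definition highest_root (theta : V) : Prop :=
  theta \in Delta /\
  forall a, a \in Delta ->
    exists n : 'I_r -> nat, theta - a = \sum_(j < r) Pi`_j *+ n j.

(* [a : Pi_j].  The coordinates of a root on simple roots are integers, so
   floor and Re merely transport them from R[i] to int. *)
Definition coef (a : V) (j : 'I_r) : int := Num.floor (complex.Re (coord Pi j a)).

Definition ht (a : V) : int := \sum_(j < r) coef a j.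

Definition Delta1 (i : 'I_r) : {fset V} := [fset a in Delta | coef a i == 1]%fset.

Definition root_le (i : 'I_r) : rel (Delta1 i) := fun m c =>
  `[< exists n : 'I_r -> nat,
        val c - val m = \sum_(j < r | j != i) Pi`_j *+ n j >].

End Roots.

Definition upper_ideal (P : finType) (le : rel P) (I : {set P}) : bool :=
  [forall x in I, forall y, le x y ==> (y \in I)].

Definition ideal_poly (P : finType) (le : rel P) : {poly int} :=
  \sum_(I : {set P} | upper_ideal le I) 'X^#|I|.

(* Main.v *)
(* Lie algebra side: if [g_a, g_-a] lay in the kernel of the root a, every
   H = [x, y] in it would commute with x and y; then ad H has only the
   eigenvalue 0 and is diagonalizable, so H = 0.  Hence g_a would lie in the
   radical of the Killing form, which must vanish by simplicity; but an
   sl2-triple (one exists, otherwise the Cartan subalgebra would be 0) has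
   integral nonzero weights, hence a positive Killing norm.  So every root has
   an sl2-triple, and sl2-theory yields reflections, root strings and
   reducedness.

   Combinatorial side: write <,> for the pairing of roots with coweights, put
   P(v) = prod_{d > 0} (u^<d,v> - u^-<d,v>) and
   A(v) = sum_{w in W} det(w) u^<2 rho, w v>.  P is proportional to A (Weyl
   denominator formula).  Let varpi be the i-th fundamental coweight and v0
   the height.  Upper ideals I of Delta(1) correspond to points x of W varpi,
   with <2 rho, x> = 2 #I - #Delta(1).  In
   (sum_x u^<2 rho, x>) A(v0) = sum_x A(x + v0) each x other than varpi has
   <a_j, x> = -1 for some j, so x + v0 is fixed by a simple reflection and
   A(x + v0) = 0.  Hence the ideal sum is a power of u times
   P(varpi + v0) / P(v0), which is the product formula in u^2. *)

Require Import Defs.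
From HB Require Import structures.
From mathcomp Require Import all_boot all_order all_algebra all_fingroup.
From mathcomp Require Import zify ring lra.
From mathcomp Require Import finmap boolp reals complex.
Set Implicit Arguments.
Unset Strict Implicit.
Unset Printing Implicit Defensive.
Import Order.TTheory GRing.Theory Num.Theory VectorInternalTheory.
Local Open Scope ring_scope.
Local Open Scope complex_scope.

(** * The Weyl denominator formula *)

(** With [s] and [t] standing for consecutive powers of [u ^+ 2], this is the ratio of two
    denominator factors at one root; abstract variables let [field] decide it. *)
Lemma cancel_factor (F : fieldType) (x y s t : F) : 1 - s != 0 ->
  x * y * (t - 1) = y * ((1 - t) / (1 - s) * (x * (s - 1))).
Proof. by move=> s1; field. Qed.

(* [co d] lists the coordinates of [d] on the simple roots [a j], and
   [(co d *m C) 0 j] is the pairing of [d] with the j-th simple coroot. *)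
Record based_roots (r : nat) (D : finType) (co : D -> 'rV[int]_r)
    (a : 'I_r -> D) (C : 'M[int]_r) : Prop := BasedRoots {
  br_inj : injective co;
  br_simple : forall j, co (a j) = delta_mx 0 j;
  br_sign : forall d, (forall k, 0 <= co d 0 k) \/ (forall k, co d 0 k <= 0);
  br_neq0 : forall d, co d != 0;
  br_diag : forall j, C j j = 2;
  br_refl : forall d j,
    exists d', co d' = co d - (co d *m C) 0 j *: delta_mx 0 j;
  br_reduced : forall d j m, co d = m *: delta_mx 0 j -> m = 1 \/ m = -1;
  br_string : forall d j, 0 < (co d *m C) 0 j -> d <> a j ->
    exists d', co d' = co d - delta_mx 0 j;
  br_opp : forall d, exists d', co d' = - co d }.

(** * Simple reflections acting on the roots *)

Section RootCombinatorics.
Variables (r : nat) (D : finType) (co : D -> 'rV[int]_r).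
Variables (a : 'I_r -> D) (C : 'M[int]_r).
Hypothesis hR : based_roots co a C.
Implicit Types (d : D) (j k : 'I_r) (w y : {perm D}) (x : 'rV[int]_r).
Implicit Types (v : 'cV[int]_r).

(** Acts on roots, which are rows, from the right, and on coweights, which are columns, from the
    left. *)
Definition reflmx j : 'M[int]_r := 1%:M - col j C *m delta_mx 0 j.

Lemma mul_reflmx x j :
  x *m reflmx j = x - (x *m C) 0 j *: delta_mx (0 : 'I_1) j.
Proof.
rewrite mulmxBr mulmx1 mulmxA; congr (_ - _).
have -> : x *m col j C = ((x *m C) 0 j)%:M.
  by apply/matrixP => p q; rewrite colE mulmxA -colE !mxE !ord1 mulr1n.
by rewrite mul_scalar_mx.
Qed.

Lemma reflmxK j : reflmx j *m reflmx j = 1%:M.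
Proof.
apply/row_matrixP => k; rewrite row_mul mul_reflmx.
set x := row k _.
have Ex : x = delta_mx 0 k - C k j *: delta_mx 0 j.
  rewrite /x rowE mul_reflmx; congr (_ - _ *: _).
  by rewrite -rowE mxE.
have -> : (x *m C) 0 j = - C k j.
  rewrite Ex mulmxBl -scalemxAl -!rowE !mxE (br_diag hR); lra.
by rewrite Ex scaleNr opprK subrK rowE mulmx1.
Qed.

(** Only column [j] differs from the identity, and its diagonal entry is [1 - 2]. *)
Lemma det_reflmx j : \det (reflmx j) = -1.
Proof.
rewrite (expand_det_row _ j) (bigD1 j) //= big1 => [|k kj]; last first.
  by rewrite !mxE big_ord1 !mxE !eqxx (br_diag hR) eq_sym (negbTE kj) mulr0 subrr mul0r.
rewrite addr0 /cofactor.
have -> : row' j (col' j (reflmx j)) = 1%:M.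
  apply/matrixP => p q; rewrite !mxE big_ord1 !mxE.
  by rewrite (inj_eq lift_inj) (eq_sym _ j) (negbTE (neq_lift _ _)) andbF mulr0 subr0.
rewrite det1 mulr1 addnn -signr_odd odd_double expr0 mulr1.
by rewrite !mxE big_ord1 !mxE !eqxx (br_diag hR).
Qed.

(** The default [d] is never the fallback in effect: [br_refl] always supplies an image. *)
Definition reflfun j d := odflt d [pick d' | co d' == co d *m reflmx j].

Lemma co_reflfun j d : co (reflfun j d) = co d *m reflmx j.
Proof.
rewrite /reflfun; case: pickP => [d' /eqP //|no].
have [d' Hd'] := br_refl hR d j.
by have := no d'; rewrite mul_reflmx Hd' eqxx.
Qed.

Lemma reflfunK j : involutive (reflfun j).
Proof.
move=> d; apply: (br_inj hR).
by rewrite !co_reflfun -mulmxA reflmxK mulmx1.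
Qed.

Definition refl j : {perm D} := perm (inv_inj (reflfunK j)).

Lemma co_refl j d : co (refl j d) = co d *m reflmx j.
Proof. by rewrite permE co_reflfun. Qed.

Definition neg d := odflt d [pick d' | co d' == - co d].

Lemma co_neg d : co (neg d) = - co d.
Proof.
rewrite /neg; case: pickP => [d' /eqP //|no].
by have [d' Hd'] := br_opp hR d; have := no d'; rewrite Hd' eqxx.
Qed.

Lemma negK : involutive neg.
Proof. by move=> d; apply: (br_inj hR); rewrite !co_neg opprK. Qed.

Definition pos d := [forall k, 0 <= co d 0 k].

Lemma posP d : reflect (forall k, 0 <= co d 0 k) (pos d).
Proof. exact: forallP. Qed.

Lemma pos_neg d : pos (neg d) = ~~ pos d.
Proof.
case: (boolP (pos d)) => [/posP p|np].
  apply/negP => /posP n; case/negP: (br_neq0 hR d).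
  apply/eqP/rowP => k; have := p k; have := n k; rewrite co_neg !mxE; lra.
apply/posP => k; rewrite co_neg mxE.
case: (br_sign hR d) => [/posP|/(_ k)]; [by rewrite (negbTE np) | by rewrite oppr_ge0].
Qed.

Lemma npos_le0 d k : ~~ pos d -> co d 0 k <= 0.
Proof.
rewrite -pos_neg => /posP /(_ k); by rewrite co_neg mxE oppr_ge0.
Qed.

Lemma pos_simple j : pos (a j).
Proof. by apply/posP => k; rewrite (br_simple hR) mxE; case: eqP. Qed.

Lemma refl_simple j : refl j (a j) = neg (a j).
Proof.
apply: (br_inj hR); rewrite co_refl co_neg mul_reflmx (br_simple hR) -rowE !mxE.
by rewrite (br_diag hR) scaler_nat mulr2n opprD addrA subrr add0r.
Qed.

(** Otherwise [d] would be a multiple of the [j]-th simple root, and [br_reduced] with positivity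
    leaves only [a j] itself. *)
Lemma pos_coord_neq d j : pos d -> d != a j -> exists2 k, k != j & 0 < co d 0 k.
Proof.
move=> pd dj; suff /existsP [k /andP []] : [exists k, (k != j) && (0 < co d 0 k)].
  by exists k.
apply: contraT; rewrite negb_exists => /forallP H.
have E : co d = co d 0 j *: delta_mx 0 j.
  apply/rowP => k; rewrite !mxE eqxx /=; case: eqP => [->|/eqP kj]; first by rewrite mulr1.
  have := H k; rewrite kj /= -leNgt mulr0 => dk; apply/eqP; rewrite eq_le dk.
  exact: posP.
have [E1|E1] := br_reduced hR E.
  by move: dj; rewrite E1 scale1r -(br_simple hR) in E; rewrite (br_inj hR E) eqxx.
by have /posP/(_ j) := pd; rewrite E1.
Qed.

(** The reflection changes only the [j]-th coordinate, so another coordinate stays positive and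
    decides the sign. *)
Lemma pos_refl j d : pos d -> d != a j -> pos (refl j d).
Proof.
move=> pd dj; have [k kj dk] := pos_coord_neq pd dj.
apply/negPn/negP => /(npos_le0 k).
by rewrite co_refl mul_reflmx !mxE (negbTE kj) andbF mulr0 subr0 leNgt dk.
Qed.

(** * The Weyl group and its matrices *)

Definition weyl : {group {perm D}} := <<[set refl j | j : 'I_r]>>%G.

Lemma refl_weyl j : refl j \in weyl.
Proof. by apply: mem_gen; apply: imset_f. Qed.

Lemma reflK j : (refl j * refl j = 1)%g.
Proof. by apply/permP => d; rewrite permM perm1 !permE reflfunK. Qed.

Lemma weyl_ind (Q : {perm D} -> Prop) :
  Q 1%g -> (forall w j, w \in weyl -> Q w -> Q (refl j * w)%g) ->
  forall w, w \in weyl -> Q w.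
Proof.
move=> Q1 QM w /gen_prodgP [n [c cA ->]].
suff: (\prod_(l < n) c l)%g \in weyl /\ Q (\prod_(l < n) c l)%g by case.
elim: n c cA => [|n IH] c cA; first by rewrite big_ord0 group1.
rewrite big_ord_recl; have [] := IH (fun l => c (lift ord0 l)).
  by move=> l; apply: cA.
move=> W Qw; have /imsetP [j _ ->] := cA ord0.
by split; [apply: groupM => //; apply: refl_weyl | apply: QM].
Qed.

(** Products of permutations act from left to right, which matches right multiplication of rows;
    hence the order of factors in [permmxM]. *)
Definition permmx w : 'M[int]_r := \matrix_j co (w (a j)).

Lemma permmx1 : permmx 1 = 1%:M.
Proof. by apply/row_matrixP => j; rewrite rowK perm1 (br_simple hR) row1. Qed.

Lemma co_weyl w : w \in weyl -> forall d, co (w d) = co d *m permmx w.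
Proof.
elim/weyl_ind: w / => [d|w j Ww IH d]; first by rewrite permmx1 perm1 mulmx1.
suff -> : permmx (refl j * w) = reflmx j *m permmx w.
  by rewrite permM IH co_refl mulmxA.
apply/row_matrixP => k; rewrite rowK permM IH co_refl row_mul.
by rewrite (br_simple hR) -rowE.
Qed.

Lemma permmxM w y : y \in weyl -> permmx (w * y) = permmx w *m permmx y.
Proof.
by move=> Wy; apply/row_matrixP => k; rewrite row_mul !rowK permM co_weyl.
Qed.

Lemma permmx_refl j : permmx (refl j) = reflmx j.
Proof. by apply/row_matrixP => k; rewrite rowK co_refl (br_simple hR) -rowE. Qed.

Lemma weyl_neg w d : w \in weyl -> w (neg d) = neg (w d).
Proof.
by move=> Ww; apply: (br_inj hR); rewrite co_neg !co_weyl // co_neg mulNmx.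
Qed.

Definition pair x v : int := (x *m v) 0 0.

Lemma pairNl x v : pair (- x) v = - pair x v.
Proof. by rewrite /pair mulNmx mxE. Qed.
Lemma pairDr x v v' : pair x (v + v') = pair x v + pair x v'.
Proof. by rewrite /pair mulmxDr mxE. Qed.
Lemma pair_mul x (M : 'M_r) v : pair x (M *m v) = pair (x *m M) v.
Proof. by rewrite /pair mulmxA. Qed.
Lemma pair_sum (I : Type) (s : seq I) (p : pred I) (f : I -> 'rV_r) v :
  pair (\sum_(l <- s | p l) f l) v = \sum_(l <- s | p l) pair (f l) v.
Proof. by rewrite /pair mulmx_suml summxE. Qed.
Lemma pair_delta k v : pair (delta_mx 0 k) v = v k 0.
Proof. by rewrite /pair -rowE mxE. Qed.
Lemma pairE x v : pair x v = \sum_k x 0 k * v k 0.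
Proof. by rewrite /pair mxE. Qed.

(* Averaging the standard form over the Weyl group gives an invariant
   positive definite form, for which pairing with the j-th simple coroot is
   a positive multiple of the product with the j-th simple root. *)
Lemma antidominant_eq0 x :
  (forall k, 0 <= x 0 k) -> (forall j, (x *m C) 0 j <= 0) -> x = 0.
Proof.
pose B (x z : 'rV[int]_r) : int := \sum_(w in weyl) ((x *m permmx w) *m (z *m permmx w)^T) 0 0.
have Bl x1 x2 z c : B (x1 + c *: x2) z = B x1 z + c * B x2 z.
  rewrite /B mulr_sumr -big_split /=; apply: eq_bigr => w _.
  by rewrite !mulmxDl -!scalemxAl !mxE.
have Bsym x1 x2 : B x1 x2 = B x2 x1.
  apply: eq_bigr => w _; rewrite -[in RHS](trmxK (x2 *m _)) -trmx_mul.
  by rewrite [RHS]mxE.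
have B0 z : B 0 z = 0 by rewrite /B big1 // => w _; rewrite mul0mx mul0mx mxE.
have Binv x1 x2 j : B (x1 *m reflmx j) (x2 *m reflmx j) = B x1 x2.
  rewrite /B [RHS](reindex (fun w => (refl j * w)%g)) /=; last first.
    by exists (fun w => (refl j * w)%g) => w _ /=; rewrite mulgA reflK mul1g.
  apply: eq_big => [w|w Ww]; first by rewrite groupMl ?refl_weyl.
  by rewrite permmxM // permmx_refl !mulmxA.
have B_ge0 z : 0 <= B z z.
  apply: sumr_ge0 => w _; rewrite mxE sumr_ge0 // => k _.
  by rewrite !mxE -expr2 sqr_ge0.
have B_eq0 z : B z z = 0 -> z = 0.
  move=> Bz; have /(_ 1%g (group1 _)) : forall w, w \in weyl ->
      ((z *m permmx w) *m (z *m permmx w)^T) 0 0 = 0.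
    apply: psumr_eq0P => // w _; rewrite mxE sumr_ge0 // => k _.
    by rewrite !mxE -expr2 sqr_ge0.
  rewrite permmx1 mulmx1 mxE => z0; apply/rowP => k; apply/eqP.
  have /(_ k isT) : forall l, true -> z 0 l * z^T l 0 = 0.
    apply: psumr_eq0P => // l _; by rewrite !mxE -expr2 sqr_ge0.
  by rewrite !mxE => /eqP; rewrite mulf_eq0 orbb.
move=> x0 xC; apply: B_eq0; apply/eqP; rewrite eq_le B_ge0 andbT.
pose e j : 'rV[int]_r := delta_mx 0 j.
(* Compare [B (e j) z] with its value after the [j]-th reflection, which negates [e j]. *)
have Be z j : B (e j) z * 2 = (z *m C) 0 j * B (e j) (e j).
  have Ee : e j *m reflmx j = 0 + (-1) *: e j.
    rewrite mul_reflmx -rowE mxE (br_diag hR) scaler_nat mulr2n opprD addrA.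
    by rewrite subrr scaleN1r.
  have := Binv (e j) z j; rewrite Ee Bl B0 add0r mul_reflmx -scaleNr.
  rewrite (Bsym (e j) (z + _)) Bl (Bsym z (e j)); lra.
have -> : B x x = \sum_j x 0 j * B (e j) x.
  have {1}-> : x = \sum_j x 0 j *: e j by exact: row_sum_delta.
  elim/big_rec2: _ => [|j s1 s2 _ <-]; first exact: B0.
  by rewrite addrC Bl addrC.
apply: sumr_le0 => j _; apply: mulr_ge0_le0 => //.
by rewrite -(pmulr_lle0 _ (isT : 0 < 2 :> int)) Be mulr_le0_ge0.
Qed.

Lemma exists_pos_cartan d : pos d -> exists j, 0 < (co d *m C) 0 j.
Proof.
move=> /posP pd; apply/existsP; apply: contraT; rewrite negb_exists.
move=> /forallP H; case/negP: (br_neq0 hR d); apply/eqP.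
by apply: antidominant_eq0 => // j; rewrite leNgt.
Qed.

(** Twice the Weyl vector, so that coordinates stay integral. *)
Definition rho2 : 'rV[int]_r := \sum_(d | pos d) co d.

Lemma refl_posD j d :
  (pos (refl j d) && (refl j d != a j)) = (pos d && (d != a j)).
Proof.
have H d1 : pos d1 && (d1 != a j) -> pos (refl j d1) && (refl j d1 != a j).
  case/andP=> pd dj; rewrite pos_refl //=; apply: contraTneq pd => rd.
  have -> : d1 = neg (a j) by rewrite -refl_simple -rd -permM reflK perm1.
  by rewrite pos_neg pos_simple.
apply/idP/idP => [/H|/H //]; by rewrite -permM reflK perm1.
Qed.

(** The reflection permutes the positive roots other than [a j]. The form with any commutative
    monoid serves both the sum [rho2] and the product [denom]. *)
Lemma big_pos_refl (M : Type) (idx : M) (op : Monoid.com_law idx)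
    (f : D -> M) j :
  \big[op/idx]_(d | pos d) f (refl j d) =
  op (f (neg (a j))) (\big[op/idx]_(d | pos d && (d != a j)) f d).
Proof.
rewrite (bigD1 (a j)) ?pos_simple //= refl_simple; congr (op _ _).
rewrite [RHS](reindex_inj (@perm_inj _ (refl j))) /=.
by apply: eq_bigl => d; rewrite refl_posD.
Qed.

Lemma rho2_refl j : rho2 *m reflmx j = rho2 - 2 *: co (a j).
Proof.
rewrite /rho2 mulmx_suml (eq_bigr (fun d => co (refl j d))) => [|d _]; last first.
  by rewrite co_refl.
rewrite (big_pos_refl _ co) [in RHS](bigD1 (a j)) ?pos_simple //= co_neg.
rewrite addrAC scaler_nat mulr2n opprD addrA subrr add0r.
by [].
Qed.

Lemma rho2_cartan j : (rho2 *m C) 0 j = 2.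
Proof.
have := rho2_refl j; rewrite mul_reflmx (br_simple hR) => /addrI /oppr_inj.
by move=> /rowP /(_ j); rewrite !mxE !eqxx !mulr1.
Qed.

(* Both sides are half of the sum of [|co d|] over all roots. *)
Lemma sum_abs_weyl w k : w \in weyl ->
  \sum_(d | pos d) `|co (w d) 0 k| = rho2 0 k.
Proof.
move=> Ww; pose h d : int := `|co d 0 k|.
have hneg d : h (neg d) = h d by rewrite /h co_neg mxE normrN.
have dbl (y : {perm D}) : y \in weyl ->
    (\sum_(d | pos d) h (y d)) *+ 2 = \sum_d h (y d).
  move=> Wy; rewrite [RHS](bigID pos) /= mulr2n; congr (_ + _).
  rewrite (reindex_inj (can_inj negK)) /=; apply: eq_big => [d|d _].
    by rewrite pos_neg.
  by rewrite weyl_neg // hneg.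
have -> : rho2 0 k = \sum_(d | pos d) h ((1%g : {perm D}) d).
  rewrite summxE; apply: eq_bigr => d /posP pd.
  by rewrite perm1 /h ger0_norm.
apply: (@pmulrnI int 2) => //; rewrite [LHS](dbl w Ww) [RHS](dbl _ (group1 _)).
have tot (y : {perm D}) : \sum_d h (y d) = \sum_d h d.
  by rewrite [RHS](reindex_inj (@perm_inj _ y)).
by rewrite !tot.
Qed.

(** * Alternating sums and the Weyl denominator *)

Variables (F : fieldType) (u : F).
Hypothesis F0 : forall n, (n.+1%:R : F) != 0.
Hypothesis u0 : u != 0.

Definition eps w : F := (\det (permmx w))%:~R.

Lemma eps1 : eps 1%g = 1.
Proof. by rewrite /eps permmx1 det1. Qed.

Lemma epsM w y : y \in weyl -> eps (w * y)%g = eps w * eps y.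
Proof. by move=> Wy; rewrite /eps permmxM // det_mulmx intrM. Qed.

Lemma eps_refl j : eps (refl j) = -1.
Proof. by rewrite /eps permmx_refl det_reflmx mulrN1z. Qed.

Lemma eps_sqr w : w \in weyl -> eps w * eps w = 1.
Proof.
elim/weyl_ind: w / => [|w j Ww IH]; first by rewrite eps1 mulr1.
by rewrite epsM // eps_refl !mulN1r mulrNN.
Qed.

Definition denom v : F :=
  \prod_(d | pos d) (u ^ pair (co d) v - u ^ (- pair (co d) v)).

(** Under a simple reflection the factor of [a j] changes sign and the other factors are
    permuted. *)
Lemma denom_weyl w v : w \in weyl -> denom (permmx w *m v) = eps w * denom v.
Proof.
move=> Ww; elim/weyl_ind: w / Ww v => [|w j Ww IH] v.
  by rewrite permmx1 mul1mx eps1 mul1r.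
rewrite permmxM // epsM // eps_refl -mulmxA mulN1r mulNr -IH permmx_refl.
set v' := _ *m v; rewrite /denom.
pose f d : F := u ^ pair (co d) v' - u ^ (- pair (co d) v').
rewrite (eq_bigr (fun d => f (refl j d))) => [|d _]; last first.
  by rewrite /f pair_mul co_refl.
rewrite big_pos_refl [in RHS](bigD1 (a j)) ?pos_simple //= -mulNr.
by rewrite /f co_neg pairNl opprK opprB.
Qed.

Definition alt (l : 'rV[int]_r) v : F :=
  \sum_(y in weyl) eps y * u ^ pair (l *m permmx y) v.

Lemma alt_weyl l w v : w \in weyl -> alt (l *m permmx w) v = eps w * alt l v.
Proof.
move=> Ww; rewrite /alt [in RHS](reindex_inj (mulgI w)) mulr_sumr /=.
apply: eq_big => [y|y Wy]; first by rewrite groupMl.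
rewrite permmxM // epsM // !mulmxA !mulrA; congr (_ * _).
by rewrite eps_sqr // mul1r.
Qed.

Lemma eq_opp0 (z : F) : z = - z -> z = 0.
Proof.
move=> /eqP; rewrite -addr_eq0 -mulr2n -mulr_natl mulf_eq0 (negbTE (F0 1)) /=.
by move/eqP.
Qed.

(** The reflection fixes [l] but negates the alternating sum, which is thus its own opposite. *)
Lemma alt_fix l j v : (l *m C) 0 j = 0 -> alt l v = 0.
Proof.
move=> l0; apply: eq_opp0; rewrite -mulN1r -(eps_refl j) -alt_weyl ?refl_weyl //.
by rewrite permmx_refl mul_reflmx l0 scale0r subr0.
Qed.

Lemma alt_weylr l w v : w \in weyl -> alt l (permmx w *m v) = eps w * alt l v.
Proof.
move=> Ww; rewrite /alt [in RHS](reindex_inj (mulIg w)) mulr_sumr /=.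
apply: eq_big => [y|y Wy]; first by rewrite groupMr.
rewrite permmxM // epsM // pair_mul !mulmxA.
by rewrite [eps y * eps w]mulrC !mulrA eps_sqr // mul1r.
Qed.

Lemma reflmx_fix j v : v j 0 = 0 -> reflmx j *m v = v.
Proof.
move=> v0; rewrite mulmxBl mul1mx -mulmxA -rowE.
have -> : row j v = 0 by apply/rowP => k; rewrite !mxE (ord1 k) v0.
by rewrite mulmx0 subr0.
Qed.

Lemma alt_fixr l j v : v j 0 = 0 -> alt l v = 0.
Proof.
move=> v0; apply: eq_opp0; rewrite -mulN1r -(eps_refl j) -alt_weylr ?refl_weyl //.
by rewrite permmx_refl reflmx_fix.
Qed.

(** Exponent of the term of the expanded [denom] that takes the first summand exactly at the
    positive roots in [J]. *)
Definition signed_sum (J : {set D}) : 'rV[int]_r :=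
  \sum_(d | pos d) (if d \in J then co d else - co d).

Lemma denom_expand v :
  denom v = \sum_(J : {set D})
    (\prod_(d : D) (if d \in J then 1 else if pos d then -1 else 0)) *
    u ^ pair (signed_sum J) v.
Proof.
rewrite /denom big_mkcond /=.
(* Roots that are not positive get the factor [1 + 0]: they must lie in [J], so each choice of signs
   counts once. *)
rewrite (eq_bigr (fun d => (if pos d then u ^ pair (co d) v else 1) +
   (if pos d then - u ^ (- pair (co d) v) else 0))) => [|d _]; last first.
  by case: (pos d); rewrite ?addr0.
rewrite bigA_distr; apply: eq_bigr => J _.
rewrite /signed_sum pair_sum.
have -> : u ^ (\sum_(d | pos d) pair (if d \in J then co d else - co d) v) =
   \prod_(d | pos d) u ^ pair (if d \in J then co d else - co d) v.
  by elim/big_rec2: _ => [|d m1 m2 _ <-]; rewrite ?expr0z // expfzDr.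
rewrite [X in _ * X]big_mkcond -big_split /=; apply: eq_bigr => d _.
case: (pos d); case: (d \in J); rewrite ?mul1r ?mulr1 //.
by rewrite mulN1r pairNl.
Qed.

(** Triangle inequality: by [sum_abs_weyl] the absolute values add up to [rho2 0 k] whatever [w]
    is. *)
Lemma signed_sum_le J w k : w \in weyl ->
  (signed_sum J *m permmx w) 0 k <= rho2 0 k.
Proof.
move=> Ww; rewrite -(sum_abs_weyl k Ww) /signed_sum mulmx_suml summxE.
apply: ler_sum => d _; case: ifP => _; rewrite ?mulNmx -co_weyl // ?mxE.
  exact: ler_norm.
by rewrite -normrN ler_norm.
Qed.

(** A simple reflection moves [rho2] by twice a root, so the coset of [rho2] modulo twice the root
    lattice is stable. *)
Lemma even_weyl x w : w \in weyl -> (exists z, x = rho2 - 2 *: z) ->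
  exists z, x *m permmx w = rho2 - 2 *: z.
Proof.
move=> Ww; elim/weyl_ind: w / Ww x => [|w j Ww IH] x [z ->].
  by exists z; rewrite permmx1 mulmx1.
rewrite permmxM // mulmxA; apply: IH; exists (co (a j) + z *m reflmx j).
by rewrite permmx_refl mulmxBl rho2_refl -scalemxAl scalerDr opprD addrA.
Qed.

Lemma signed_sum_even J : exists z, signed_sum J = rho2 - 2 *: z.
Proof.
exists (\sum_(d | pos d && (d \notin J)) co d).
rewrite /rho2 /signed_sum scaler_sumr.
rewrite (bigID (mem J)) [X in _ = X - _](bigID (mem J)) /= -addrA -sumrB.
congr (_ + _); apply: eq_bigr => d; first by case/andP => _ ->.
case/andP => _ /negbTE ->; rewrite scaler_nat mulr2n opprD addrA subrr.
by rewrite add0r.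
Qed.

(** The image [l] of greatest height is dominant. If some pairing with a simple coroot is 0, the
    alternating sum vanishes. Otherwise [l] is [rho2 - 2 *: z] with [z] nonnegative; positive
    pairings of [l] make those of [z] at most 0, so [z] is 0 by [antidominant_eq0]. *)
Lemma alt_signed_sum J :
  exists c : F, forall v, alt (signed_sum J) v = c * alt rho2 v.
Proof.
pose hgt w : int := \sum_k (signed_sum J *m permmx w) 0 k.
case: (@Order.TotalTheory.arg_maxP _ _ _ 1%g (mem weyl) hgt (group1 _)) => w Ww Hmax.
set l := signed_sum J *m permmx w.
have altJ v : alt (signed_sum J) v = eps w * alt l v.
  by rewrite alt_weyl // mulrA eps_sqr // mul1r.
have l_ge0 j : 0 <= (l *m C) 0 j.
  have := Hmax _ (groupM Ww (refl_weyl j)).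
  rewrite /hgt permmxM ?refl_weyl // mulmxA -/l permmx_refl mul_reflmx /=.
  have -> : \sum_k (l - (l *m C) 0 j *: delta_mx (0 : 'I_1) j) 0 k =
      \sum_k l 0 k - (l *m C) 0 j.
    rewrite (eq_bigr (fun k => l 0 k -
        (l *m C) 0 j * (delta_mx 0 j : 'rV[int]_r) 0 k)); last by move=> k _; rewrite !mxE.
    have e1 : \sum_k (delta_mx 0 j : 'rV[int]_r) 0 k = 1.
      rewrite (bigD1 j) //= big1 => [|k kj]; first by rewrite mxE !eqxx.
      by rewrite mxE (negbTE kj) andbF.
    by rewrite sumrB -mulr_sumr e1 mulr1.
  by rewrite gerBl.
have [/existsP [j /eqP lj]|] := boolP [exists j, (l *m C) 0 j == 0].
  by exists 0 => v; rewrite altJ (alt_fix _ lj) mulr0 mul0r.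
rewrite negb_exists => /forallP lC.
suff El : l = rho2 by exists (eps w) => v; rewrite altJ El.
have [z Ez] : exists z, l = rho2 - 2 *: z.
  by apply: even_weyl => //; apply: signed_sum_even.
suff z0 : z = 0 by rewrite Ez z0 scaler0 subr0.
apply: antidominant_eq0 => [k|j].
  have : (rho2 - 2 *: z) 0 k <= rho2 0 k by rewrite -Ez signed_sum_le.
  by rewrite mxE gerDl mxE oppr_le0 mxE; move: (z 0 k) => n; clear; lia.
have := lC j; have := l_ge0 j; rewrite Ez mulmxBl -scalemxAl.
have -> : (rho2 *m C - 2 *: (z *m C)) 0 j = 2 - 2 * (z *m C) 0 j.
  by rewrite -(rho2_cartan j) !mxE.
by move: ((z *m C) 0 j) => n; clear; lia.
Qed.

(** Antisymmetrizing [denom] multiplies it by the group order and turns each term of its expansion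
    into an alternating sum. One [c] serves all [v], so values at two points can be compared. *)
Lemma weyl_denominator :
  exists c : F, forall v, #|weyl|%:R * denom v = c * alt rho2 v.
Proof.
pose s (J : {set D}) : F := \prod_d (if d \in J then 1 else if pos d then -1 else 0).
have E v : #|weyl|%:R * denom v = \sum_J s J * alt (signed_sum J) v.
  have -> : #|weyl|%:R * denom v = \sum_(y in weyl) eps y * denom (permmx y *m v).
    rewrite -sum1_card natr_sum mulr_suml; apply: eq_bigr => y Wy.
    by rewrite denom_weyl // mulrA eps_sqr.
  under eq_bigr => y _ do rewrite denom_expand mulr_sumr.
  rewrite exchange_big; apply: eq_bigr => J _; rewrite mulr_sumr.
  by apply: eq_bigr => y _; rewrite pair_mul mulrCA.
have /fin_all_exists [c Hc] := alt_signed_sum.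
exists (\sum_J s J * c J) => v; rewrite E mulr_suml.
by apply: eq_bigr => J _; rewrite Hc mulrA.
Qed.

(** * Upper ideals of a cominuscule grade *)

Variable i : 'I_r.
Hypothesis comin : forall d, `|co d 0 i| <= 1.
Variables (Q : finType) (e : Q -> D) (le : rel Q).
Hypothesis e_inj : injective e.
Hypothesis e_coef : forall q, co (e q) 0 i = 1.
Hypothesis e_surj : forall d, co d 0 i = 1 -> exists q, e q = d.
Hypothesis leP : forall q q',
  reflect (forall k, co (e q) 0 k <= co (e q') 0 k) (le q q').

Lemma coef_cases d : [\/ co d 0 i = 0, co d 0 i = 1 | co d 0 i = -1].
Proof.
have := comin d; move: (co d 0 i) => n; rewrite ler_norml => /andP [? ?].
have : n = 0 \/ n = 1 \/ n = -1 by lia.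
by case=> [|[|]] ->; [constructor 1|constructor 2|constructor 3].
Qed.

Lemma pos_coef1 d : co d 0 i = 1 -> pos d.
Proof. by move=> d1; apply/negPn/negP => /(npos_le0 i); rewrite d1. Qed.

Lemma big_grade1 (M : Type) (idx : M) (op : Monoid.com_law idx) (f : D -> M) :
  \big[op/idx]_(d | co d 0 i == 1) f d = \big[op/idx]_q f (e q).
Proof.
rewrite (eq_bigl (mem [set e q | q : Q])) => [|d]; last first.
  apply/eqP/imsetP => [/e_surj [q <-]|[q _ ->]]; [by exists q | exact: e_coef].
by rewrite big_imset /=; [apply: eq_bigl => q; rewrite inE | move=> ? ? _ _ /e_inj].
Qed.

Lemma co_weylE w d k : w \in weyl ->
  co (w d) 0 k = \sum_l co d 0 l * co (w (a l)) 0 k.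
Proof. by move=> Ww; rewrite co_weyl // mxE; apply: eq_bigr => l _; rewrite !mxE. Qed.

(* Minimal coset representatives modulo the stabilizer of the i-th fundamental
   coweight. *)
Definition adapted : {set {perm D}} :=
  [set w in weyl | [forall d, (co d 0 i == 0) && pos d ==> pos (w d)]].

Lemma adaptedP w : reflect
  (w \in weyl /\ forall d, co d 0 i = 0 -> pos d -> pos (w d)) (w \in adapted).
Proof.
rewrite inE; apply: (iffP andP) => -[Ww H]; split=> //.
  by move=> d d0 pd; move/forallP/(_ d): H; rewrite d0 pd.
by apply/forallP => d; apply/implyP => /andP [/eqP d0 pd]; apply: H.
Qed.

Lemma adapted_weyl w : w \in adapted -> w \in weyl.
Proof. by case/adaptedP. Qed.

Lemma adapted_grade0 w d : w \in adapted -> co d 0 i = 0 -> pos (w d) = pos d.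
Proof.
case/adaptedP=> Ww H d0; apply/idP/idP; last exact: H.
apply: contraTT => nd; rewrite -pos_neg -weyl_neg //; apply: H.
  by rewrite co_neg mxE d0 oppr0.
by rewrite pos_neg.
Qed.

Definition noninv w : {set Q} := [set q | pos (w (e q))].

Lemma noninv_upper w : w \in adapted -> upper_ideal le (noninv w).
Proof.
move=> Aw; have Ww := adapted_weyl Aw; have [_ Hw] := adaptedP _ Aw.
apply/forall_inP => q; rewrite inE => /posP wq; apply/forallP => q'.
apply/implyP => /leP qq'; rewrite inE; apply/posP => k.
apply: le_trans (wq k) _; rewrite !co_weylE //; apply: ler_sum => l _.
have [->|li] := eqVneq l i; first by rewrite !e_coef.
apply: ler_wpM2r => //; apply/posP: k; apply: Hw (pos_simple l).
by rewrite (br_simple hR) mxE eq_sym (negbTE li) andbF.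
Qed.

(** If [w (e q)] is not simple, it is a positive root plus some [a j]. Pulled back by [w], this
    splits [e q] into two roots of total grade 1. If the grades are 0 and 1, the grade-one part is a
    smaller element of [noninv w]; otherwise one grade is 2, against [comin]. *)
Lemma minimal_to_simple w q : w \in adapted -> q \in noninv w ->
  (forall q', le q' q -> q' != q -> q' \notin noninv w) ->
  exists j, w (e q) = a j.
Proof.
move=> Aw; rewrite inE => pq Hmin; have Ww := adapted_weyl Aw.
have [j nj] := exists_pos_cartan pq; exists j; apply/eqP/negPn/negP => wj.
have [b Eb] := br_string hR nj (elimN eqP wj).
have pb : pos b.
  have [k kj wk] := pos_coord_neq pq wj; apply/negPn/negP => /(npos_le0 k).
  by rewrite Eb !mxE (negbTE kj) andbF subr0 leNgt wk.
pose g' := (w^-1)%g b; pose dl := (w^-1)%g (a j).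
have wg' : w g' = b by rewrite /g' permKV.
have wdl : w dl = a j by rewrite /dl permKV.
have Eg : co g' = co (e q) - co dl.
  have WV := groupVr Ww; rewrite -[in RHS](permK w (e q)) /g' /dl !(co_weyl WV).
  by rewrite Eb mulmxBl (br_simple hR).
have Ei : co g' 0 i = 1 - co dl 0 i by rewrite Eg !mxE e_coef.
have below q' d : co d = co (e q) - co (e q') -> pos d -> ~~ pos (w (e q')).
  move=> Ed /posP pd; have : q' \notin noninv w.
    apply: Hmin; first by apply/leP => k; have := pd k; rewrite Ed !mxE subr_ge0.
    by apply: contra (br_neq0 hR d) => /eqP qq; rewrite Ed qq subrr.
  by rewrite inE.
have [d0|d1|dN] := coef_cases dl.
- have [q' Eq] : exists q', e q' = g' by apply: e_surj; rewrite Ei d0 subr0.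
  have := below q' dl; rewrite Eq wg' pb => H.
  suff: ~~ true by []; apply: H; first by rewrite Eg opprB addrC subrK.
  by rewrite -(adapted_grade0 Aw) // wdl pos_simple.
- have [q' Eq] := e_surj d1.
  have := below q' g'; rewrite Eq wdl pos_simple => H.
  suff: ~~ true by []; apply: (H Eg).
  by rewrite -(adapted_grade0 Aw) ?wg' // Ei d1 subrr.
- by have := comin g'; rewrite Ei dN.
Qed.

(** Induction on the complement: add to [I] an element [q] of greatest height outside it. For the
    resulting [w], [q] is minimal in [noninv w], so [w (e q)] is some [a j], and following [w] by
    the [j]-th reflection removes exactly [q]. *)
Lemma noninv_surj I : upper_ideal le I -> exists2 w, w \in adapted & noninv w = I.
Proof.
move En: #|~: I| => n; elim: n I En => [|n IH] I En uI.
  exists 1%g; first by apply/adaptedP; split=> // d _; rewrite perm1.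
  have /eqP : ~: I == set0 by rewrite -cards_eq0 En.
  move/(congr1 (@setC _)); rewrite setCK setC0 => ->.
  by apply/setP => q; rewrite !inE perm1 pos_coef1.
have upI q q' : q \in I -> le q q' -> q' \in I.
  by move=> qI qq'; move/forall_inP/(_ q qI)/forallP/(_ q')/implyP: uI; apply.
pose hgt q : int := \sum_k co (e q) 0 k.
have [q0 q0I] : exists q, q \in ~: I by apply/set0Pn; rewrite -cards_eq0 En.
case: (@Order.TotalTheory.arg_maxP _ _ _ q0 (mem (~: I)) hgt q0I) => q.
move=> qI' Hq; have qI : q \notin I by rewrite -in_setC.
have hgt_lt q1 q2 : le q1 q2 -> q1 != q2 -> hgt q1 < hgt q2.
  move=> /leP l12 n12; rewrite lt_neqAle ler_sum // andbT.
  apply: contra n12 => /eqP; rewrite /hgt => E; apply/eqP/e_inj/(br_inj hR).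
  apply/rowP => k; apply/eqP; rewrite eq_sym -subr_eq0; apply/eqP.
  apply: (psumr_eq0P (P := xpredT) (F := fun k => co (e q2) 0 k - co (e q1) 0 k)) => //.
    by move=> l _; rewrite subr_ge0.
  by rewrite sumrB E subrr.
have uqI : upper_ideal le (q |: I).
  apply/forall_inP => q1; rewrite inE => /orP H; apply/forallP => q2; apply/implyP => l12.
  rewrite !inE; case: H => [|q1I]; last by rewrite (upI _ _ q1I l12) orbT.
  rewrite inE => /eqP E1; rewrite E1 in l12 => {q1 E1}.
  case: eqVneq => //= n2; apply: contraT => q2I.
  have q2I' : q2 \in ~: I by rewrite inE.
  have := Hq q2 q2I'.
  by rewrite /= leNgt hgt_lt // eq_sym.
have [|w Aw Ew] := IH (q |: I) _ uqI.
  move: En; rewrite (cardsD1 q) inE qI => -[<-].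
  by congr #|pred_of_set _|; apply/setP => q'; rewrite !inE negb_or.
have Ww := adapted_weyl Aw; have [_ Hw] := adaptedP _ Aw.
have [||j Ej] := @minimal_to_simple w q Aw.
- by rewrite Ew !inE eqxx.
- move=> q' l' n'; rewrite Ew !inE negb_or n' /=.
  by apply: contra qI => q'I; apply: upI q'I l'.
exists (w * refl j)%g.
  apply/adaptedP; split; first by rewrite groupM ?refl_weyl.
  move=> d d0 pd; rewrite permM pos_refl ?Hw //.
  apply/negP => /eqP wd.
  have Eq : e q = d by apply: (@perm_inj _ w); rewrite wd Ej.
  by have := e_coef q; rewrite Eq d0.
apply/setP => q'; rewrite inE permM; have [->|nq] := eqVneq q' q.
  by rewrite Ej refl_simple pos_neg pos_simple (negbTE qI).
have E' : (q' \in noninv w) = (q' \in I) by rewrite Ew !inE (negbTE nq).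
rewrite -E' inE.
have wa : w (e q') != a j.
  by rewrite -Ej (inj_eq perm_inj) (inj_eq e_inj).
have := refl_posD j (w (e q')); rewrite wa andbT => <-.
case: eqVneq; rewrite ?andbT // => E.
have : w (e q') = w (neg (e q)).
  by rewrite weyl_neg // Ej -refl_simple -E -permM reflK perm1.
by move/perm_inj => E2; have := e_coef q'; rewrite E2 co_neg mxE e_coef.
Qed.

(* The image under [w] of the i-th fundamental coweight: [permmx] acts on
   coweights contravariantly, whence the inverse. *)
Definition orbit_pt w : 'cV[int]_r := permmx w^-1%g *m delta_mx i 0.

Lemma pair_coef x : pair x (delta_mx i 0) = x 0 i.
Proof. by rewrite /pair -colE mxE. Qed.

Lemma pair_orbit_pt w d : w \in weyl ->
  pair (co d) (orbit_pt w) = co ((w^-1)%g d) 0 i.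
Proof.
by move=> Ww; rewrite /orbit_pt pair_mul -co_weyl ?groupV // pair_coef.
Qed.

Lemma orbit_ptE w j : w \in weyl -> orbit_pt w j 0 = co ((w^-1)%g (a j)) 0 i.
Proof. by move=> Ww; rewrite -pair_orbit_pt // (br_simple hR) pair_delta. Qed.

(** When [w * refl j] is adapted too, the two terms are exchanged. When it is not, [w] sends a
    positive root of grade 0 to [a j], so [a j] pairs to 0 with the orbit point, which the
    reflection then fixes. *)
Lemma sum_adapted_refl (f : 'cV[int]_r -> F) j :
  \sum_(w in adapted) f (reflmx j *m orbit_pt w) =
  \sum_(w in adapted) f (orbit_pt w).
Proof.
rewrite (bigID (fun w => (w * refl j)%g \in adapted)) /=.
rewrite [RHS](bigID (fun w => (w * refl j)%g \in adapted)) /=; congr (_ + _).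
  rewrite [RHS](reindex_inj (mulIg (refl j))) /=; apply: eq_big => [w|w].
    by rewrite -mulgA reflK mulg1 andbC.
  case/andP=> Aw _; congr f; rewrite /orbit_pt invMg permmxM; last first.
    by rewrite groupV (adapted_weyl Aw).
  have -> : ((refl j)^-1 = refl j)%g by apply/eqP; rewrite eq_invg_mul reflK.
  by rewrite permmx_refl mulmxA.
apply: eq_bigr => w /andP [Aw nA]; congr f; apply: reflmx_fix.
have [Ww Hw] := adaptedP _ Aw.
have : ~~ [forall d, (co d 0 i == 0) && pos d ==> pos ((w * refl j)%g d)].
  by apply: contra nA; rewrite inE groupM ?refl_weyl.
rewrite negb_forall => /existsP [d]; rewrite negb_imply -andbA permM.
case/and3P=> /eqP d0 pd npd; rewrite orbit_ptE //.
have [<-|wd] := eqVneq (w d) (a j); first by rewrite permK.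
by move: npd; rewrite pos_refl // Hw.
Qed.

Lemma sum_adapted_weyl (f : 'cV[int]_r -> F) y : y \in weyl ->
  \sum_(w in adapted) f (permmx y *m orbit_pt w) =
  \sum_(w in adapted) f (orbit_pt w).
Proof.
move=> Wy; elim/weyl_ind: y / Wy f => [|y j Wy IH] f.
  by apply: eq_bigr => w _; rewrite permmx1 mul1mx.
rewrite permmxM // permmx_refl.
have := IH (fun v => f (reflmx j *m v)); rewrite sum_adapted_refl => <-.
by apply: eq_bigr => w _; rewrite mulmxA.
Qed.

(** * The orbit sum and its product with the denominator *)

Definition orbit_sum : F := \sum_(w in adapted) u ^ pair rho2 (orbit_pt w).

(** The orbit sum is invariant, so each term [y] of [alt] may be multiplied by the sum translated by
    [y]. *)
Lemma orbit_sum_alt v :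
  orbit_sum * alt rho2 v = \sum_(w in adapted) alt rho2 (orbit_pt w + v).
Proof.
rewrite /alt exchange_big mulr_sumr; apply: eq_bigr => y Wy.
rewrite /orbit_sum -(sum_adapted_weyl (fun v => u ^ pair rho2 v) Wy) mulr_suml.
apply: eq_bigr => w _; by rewrite pair_mul pairDr expfzDr // mulrCA.
Qed.

(* This group is trivial; keeping it as a multiplicity avoids proving that the
   Weyl group acts simply transitively on bases. *)
Definition pos_stab : {set {perm D}} :=
  [set w in weyl | [forall d, pos d ==> pos (w d)]].

Lemma pos_stabP w : reflect
  (w \in weyl /\ forall d, pos (w d) = pos d) (w \in pos_stab).
Proof.
rewrite inE; apply: (iffP andP) => -[Ww H]; split=> //; last first.
  by apply/forallP => d; rewrite H implybb.
have {}H d : pos d -> pos (w d) by move/forallP/(_ d): H => /implyP.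
move=> d; apply/idP/idP; last exact: H.
by apply: contraTT => nd; rewrite -pos_neg -weyl_neg // H // pos_neg.
Qed.

Definition htv : 'cV[int]_r := const_mx 1.
Definition ht_ d : int := pair (co d) htv.

Lemma ht_E d : ht_ d = \sum_k co d 0 k.
Proof. by rewrite /ht_ pairE; apply: eq_bigr => k _; rewrite mxE mulr1. Qed.

Lemma ht_gt0 d : pos d -> 0 < ht_ d.
Proof.
move/posP=> pd; rewrite ht_E lt_neqAle sumr_ge0 // andbT eq_sym.
apply: contra (br_neq0 hR d) => /eqP E; apply/eqP/rowP => k.
by rewrite mxE; apply: (psumr_eq0P _ E).
Qed.

Lemma ht_simple j : ht_ (a j) = 1.
Proof. by rewrite /ht_ (br_simple hR) pair_delta mxE. Qed.

Lemma ht_weylE w d : w \in weyl -> ht_ (w d) = \sum_l co d 0 l * ht_ (w (a l)).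
Proof.
move=> Ww; rewrite ht_E; under eq_bigr => k _ do rewrite co_weylE //.
by rewrite exchange_big; apply: eq_bigr => l _; rewrite ht_E mulr_sumr.
Qed.

(** The height 1 of [a j] is the sum of the coordinates of [w (a j)] weighted by the heights of the
    roots [w^-1 (a l)]. These are positive, of height at least 1, so [w (a j)] has height at most
    1. *)
Lemma ht_pos_stab w d : w \in pos_stab -> ht_ (w d) = ht_ d.
Proof.
case/pos_stabP=> Ww pw.
have s1 j : ht_ (w (a j)) = 1.
  apply/eqP; rewrite eq_le; apply/andP; split; last first.
    by rewrite -gtz0_ge1 ht_gt0 // pw pos_simple.
  have WV := groupVr Ww.
  rewrite -[X in _ <= X](ht_simple j).
  have -> : ht_ (a j) = \sum_l co (w (a j)) 0 l * ht_ ((w^-1)%g (a l)).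
    by rewrite -ht_weylE // permK.
  rewrite ht_E; apply: ler_sum => l _; apply: ler_peMr.
    by apply/posP; rewrite pw pos_simple.
  by rewrite -gtz0_ge1 ht_gt0 // -pw permKV pos_simple.
by rewrite ht_weylE // ht_E; apply: eq_bigr => l _; rewrite s1 mulr1.
Qed.

(** If some coordinate of the orbit point is -1, adding [htv] makes it 0. Otherwise [w^-1] sends
    positive roots to grades at least 0, so a positive root made negative by [w] would have grade 0,
    against adaptedness; then [w] would lie in [pos_stab]. *)
Lemma alt_orbit_pt0 w : w \in adapted -> w \notin pos_stab ->
  alt rho2 (orbit_pt w + htv) = 0.
Proof.
move=> Aw nw; have [Ww Hw] := adaptedP _ Aw; have WV := groupVr Ww.
have [/existsP [j /eqP Ej]|] := boolP [exists j, co ((w^-1)%g (a j)) 0 i == -1].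
  by apply: (alt_fixr _ (j := j)); rewrite mxE orbit_ptE // Ej mxE.
rewrite negb_exists => /forallP H; case/negP: nw; rewrite inE Ww.
have ge0 d : pos d -> 0 <= co ((w^-1)%g d) 0 i.
  move/posP=> pd; rewrite co_weylE // sumr_ge0 // => l _; apply: mulr_ge0 => //.
  by case: (coef_cases ((w^-1)%g (a l))) => E; rewrite E // in H *; have := H l; rewrite E.
apply/forallP => d; apply/implyP => pd; apply: contraT; rewrite -pos_neg => np.
have := ge0 _ np; rewrite -weyl_neg // permK co_neg mxE => le0.
have d0 : co d 0 i = 0 by apply/eqP; rewrite eq_le (posP _ pd) -oppr_ge0 le0.
by move: np; rewrite pos_neg Hw.
Qed.

Lemma denom_orbit_pt w : w \in pos_stab ->
  denom (orbit_pt w + htv) = denom (delta_mx i 0 + htv).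
Proof.
move=> Gw; have [Ww pw] := pos_stabP _ Gw.
rewrite /denom (reindex_inj (@perm_inj _ w)) /=; apply: eq_big => // d _.
rewrite !pairDr pair_orbit_pt // permK -!/(ht_ _) ht_pos_stab //.
by rewrite pair_coef.
Qed.

Lemma card_neq0 (T : finType) (A : {set T}) t : t \in A -> #|A|%:R != 0 :> F.
Proof. by move=> At; rewrite (cardD1 t) At add1n; apply: F0. Qed.

Lemma orbit_sum_denom :
  orbit_sum * denom htv = #|pos_stab|%:R * denom (delta_mx i 0 + htv).
Proof.
have [c Hc] := weyl_denominator.
have nz : #|weyl|%:R != 0 :> F by apply: (card_neq0 (group1 weyl)).
apply: (mulfI nz); rewrite mulrCA Hc mulrCA orbit_sum_alt mulr_sumr.
rewrite (bigID (mem pos_stab)) /= [X in _ + X]big1 => [|w /andP [Aw nw]]; last first.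
  by rewrite alt_orbit_pt0 // mulr0.
rewrite addr0 (eq_big (mem pos_stab) (fun=> #|weyl|%:R * denom (delta_mx i 0 + htv))).
- by rewrite sumr_const -[LHS]mulr_natl mulrCA.
- move=> w; rewrite /= andb_idl // => Gw.
  have [Ww pw] := pos_stabP _ Gw.
  by apply/adaptedP; split=> // d _; rewrite pw.
- by move=> w /andP [_ Gw]; rewrite -Hc denom_orbit_pt.
Qed.

(** After reindexing, the sum runs over the grades of the [d] with [w d] positive: each
    non-inversion of grade 1 counts 1, and each inversion counts -1 through its negative. *)
Lemma pair_rho2_orbit_pt w : w \in adapted ->
  pair rho2 (orbit_pt w) = #|noninv w|%:Z *+ 2 - #|Q|%:Z.
Proof.
move=> Aw; have Ww := adapted_weyl Aw.
rewrite /rho2 pair_sum (reindex_inj (@perm_inj _ w)) /=.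
rewrite (eq_bigr (fun d => co d 0 i)) => [|d _]; last first.
  by rewrite pair_orbit_pt // permK.
pose g d : int := if pos (w d) then co d 0 i else 0.
rewrite big_mkcond /= -/g (bigID (fun d => co d 0 i == 1)) /= big_grade1.
rewrite (bigID (fun d => co (neg d) 0 i == 1)) /= [X in _ + (_ + X)]big1; last first.
  move=> d; rewrite co_neg mxE /g; case: ifP => // _.
  by case: (coef_cases d) => ->.
rewrite addr0 (eq_bigl (fun d => co (neg d) 0 i == 1)) => [|d]; last first.
  by rewrite co_neg mxE; case: (coef_cases d) => ->.
rewrite (reindex_inj (can_inj negK)) /=.
rewrite (eq_bigl (fun d => co d 0 i == 1)) => [|d]; last by rewrite negK.
rewrite (big_grade1 _ (fun d => g (neg d))) -big_split /=.
have -> : #|noninv w|%:Z = \sum_q (if pos (w (e q)) then 1 else 0).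
  by rewrite -big_mkcond /= -sum1dep_card -natz natr_sum.
have -> : #|Q|%:Z = \sum_(q : Q) 1 by rewrite -natz -sum1_card natr_sum.
rewrite -sumrMnl -sumrB; apply: eq_bigr => q _.
rewrite /g weyl_neg // pos_neg co_neg mxE e_coef.
by case: (pos _).
Qed.

(** The fibre is a coset of [pos_stab]: adaptedness fixes the signs of images in grade 0, [noninv]
    those in grade 1, and negation those in grade -1. *)
Lemma card_noninv_fibre I : upper_ideal le I ->
  #|[set w in adapted | noninv w == I]| = #|pos_stab|.
Proof.
case/noninv_surj => w Aw Ew; have Ww := adapted_weyl Aw.
rewrite -(card_imset (mem pos_stab) (mulgI w)); congr #|pred_of_set _|.
apply/setP => y; rewrite inE; apply/andP/imsetP; last first.
  case=> z /pos_stabP [Wz pz] ->; split.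
    apply/adaptedP; split; first exact: groupM.
    by move=> d d0 pd; rewrite permM pz adapted_grade0.
  by rewrite -Ew; apply/eqP/setP => q; rewrite !inE permM pz.
case=> Ay /eqP Ey; have Wy := adapted_weyl Ay.
exists (w^-1 * y)%g; last by rewrite mulKVg.
have wy d : pos (y d) = pos (w d).
  have key d1 : co d1 0 i = 1 -> pos (y d1) = pos (w d1).
    move=> /e_surj [q <-]; have : (q \in noninv y) = (q \in noninv w) by rewrite Ey Ew.
    by rewrite !inE.
  have [d0|/key //|dN] := coef_cases d; first by rewrite !adapted_grade0.
  apply: negb_inj; rewrite -!pos_neg -!weyl_neg //; apply: key.
  by rewrite co_neg mxE dN opprK.
apply/pos_stabP; split; first by rewrite groupM ?groupV.
by move=> d; rewrite permM wy permKV.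
Qed.

Lemma orbit_sumE :
  orbit_sum = #|pos_stab|%:R * u ^ (- #|Q|%:Z) *
     \sum_(I | upper_ideal le I) (u ^+ 2) ^+ #|I|.
Proof.
rewrite /orbit_sum (partition_big noninv (upper_ideal le)) /=; last first.
  exact: noninv_upper.
rewrite mulr_sumr; apply: eq_bigr => I uI.
rewrite (eq_bigr (fun=> u ^ (- #|Q|%:Z) * (u ^+ 2) ^+ #|I|)) => [|w /andP [Aw /eqP Ew]].
  rewrite sumr_const -(card_noninv_fibre uI) -mulrA mulr_natl; congr (_ *+ _).
  by apply: eq_card => w; rewrite [in RHS]inE.
rewrite pair_rho2_orbit_pt // Ew addrC expfzDr // -exprM; congr (_ * _).
by rewrite exprnP mulr2n mul2n -addnn PoszD.
Qed.

Hypothesis u_free : forall n : nat, (0 < n)%N -> u ^+ n != 1.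

Lemma factorE (n : int) : u ^ n - u ^ (- n) = u ^ (- n) * ((u ^+ 2) ^ n - 1).
Proof.
rewrite mulrBr mulr1; congr (_ - _).
by rewrite (exprnP u 2) exprz_exp -expfzDr // (_ : 2%:Z = 1 + 1) // mulrDl !mul1r addKr.
Qed.

Lemma factor_neq0 (n : int) : 0 < n -> (u ^+ 2) ^ n - 1 != 0.
Proof.
case: n => // n n0; rewrite subr_eq0 -exprnP -exprM; apply: u_free.
by rewrite muln_gt0.
Qed.

(* The formula is in [u ^+ 2] because the weights of [rho2 / 2] on the orbit
   may be half-integral. *)
Lemma cominuscule_ideals :
  \sum_(I | upper_ideal le I) (u ^+ 2) ^+ #|I| =
  \prod_q ((1 - (u ^+ 2) ^ (ht_ (e q) + 1)) / (1 - (u ^+ 2) ^ ht_ (e q))).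
Proof.
set S := \sum_(I | _) _.
pose f v d : F := u ^ pair (co d) v - u ^ (- pair (co d) v).
have spl v : denom v =
    \prod_q f v (e q) * \prod_(d | pos d && (co d 0 i != 1)) f v d.
  rewrite /denom (bigID (fun d => co d 0 i == 1)) /=; congr (_ * _).
  rewrite -(big_grade1 _ (f v)); apply: eq_bigl => d.
  by rewrite andb_idl // => /eqP /pos_coef1.
have key := orbit_sum_denom; rewrite orbit_sumE -/S !spl in key.
(* The remaining positive roots have grade 0, so their factors agree at both points and cancel. *)
have E0 : \prod_(d | pos d && (co d 0 i != 1)) f (delta_mx i 0 + htv) d =
          \prod_(d | pos d && (co d 0 i != 1)) f htv d.
  apply: eq_bigr => d /andP [/posP pd d1].
  have d0 : co d 0 i = 0.
    by case: (coef_cases d) (pd i) d1 => ->; rewrite ?eqxx.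
  by rewrite /f pairDr pair_coef d0 add0r.
set R := \prod_(d | _) f htv d in key E0; rewrite E0 in key.
have fE q : f htv (e q) = u ^ (- ht_ (e q)) * ((u ^+ 2) ^ ht_ (e q) - 1).
  exact: factorE.
have fE1 q : f (delta_mx i 0 + htv) (e q) =
    u ^ (- ht_ (e q) - 1) * ((u ^+ 2) ^ (ht_ (e q) + 1) - 1).
  by rewrite /f pairDr pair_coef e_coef [1 + _]addrC factorE opprD.
have f_neq0 d : pos d -> f htv d != 0.
  by move=> pd; rewrite /f factorE mulf_neq0 ?expfz_neq0 ?factor_neq0 ?ht_gt0.
have R0 : R != 0 by apply/prodf_neq0 => d /andP [pd _]; apply: f_neq0.
have G0 : #|pos_stab|%:R != 0 :> F.
  by apply: (card_neq0 (t := 1%g)); apply/pos_stabP; split=> // d; rewrite perm1.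
have Q0 : \prod_q f htv (e q) != 0.
  by apply/prodf_neq0 => q _; apply: f_neq0; apply: pos_coef1.
have {}key : u ^ (- #|Q|%:Z) * S * \prod_q f htv (e q) =
    \prod_q f (delta_mx i 0 + htv) (e q).
  apply: (mulfI G0); apply: (mulIf R0); by rewrite -[RHS]mulrA -key !mulrA.
(* One [u ^ (-1)] per root of grade 1 allows a comparison factor by factor. *)
have uQ : u ^ (- #|Q|%:Z) = \prod_(q : Q) u ^ (-1).
  by rewrite prodr_const (exprnP (u ^ _)) exprz_exp mulN1r.
apply: (mulIf Q0); apply: (mulfI (expfz_neq0 (- #|Q|%:Z) u0)).
rewrite mulrA key uQ -!big_split /=; apply: eq_bigr => q _.
have n0 : 1 - (u ^+ 2) ^ ht_ (e q) != 0.
  by rewrite -opprB oppr_eq0 factor_neq0 // ht_gt0 // pos_coef1.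
by rewrite fE fE1 [u ^ (_ - 1)]expfzDr //; apply: cancel_factor.
Qed.
End RootCombinatorics.

(** * Weight spaces and the Killing form *)

Section MatrixFacts.
Variable K : numFieldType.

(* The trace of a commutator vanishes on the eigenspace, which is stable. *)
Lemma commutator_eigenvalue0 n (X Y H : 'M[K]_n) z :
  H = X *m Y - Y *m X -> H *m X = X *m H -> H *m Y = Y *m H ->
  eigenvalue H z -> z = 0.
Proof.
move=> EH HX HY; rewrite /eigenvalue; set E := eigenspace H z => nz.
pose B := row_base E.
have BH : B *m H = z *: B.
  by apply/eigenspaceP; rewrite eq_row_base.
have stab M : H *m M = M *m H -> exists M', B *m M = M' *m B.
  move=> HM; exists (B *m M *m pinvmx B).
  rewrite mulmxKpV // eq_row_base; apply/eigenspaceP.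
  by rewrite -mulmxA -HM mulmxA BH scalemxAl.
have [[X' EX] [Y' EY]] := (stab X HX, stab Y HY).
have key : X' *m Y' - Y' *m X' = z%:M.
  apply: (row_free_inj (row_base_free E)); rewrite -/B mulmxBl -!mulmxA.
  have -> : X' *m (Y' *m B) = B *m (X *m Y) by rewrite -EY mulmxA -EX mulmxA.
  have -> : Y' *m (X' *m B) = B *m (Y *m X) by rewrite -EX mulmxA -EY mulmxA.
  by rewrite -mulmxBr -EH BH mul_scalar_mx.
have := congr1 mxtrace key; rewrite raddfB /= mxtrace_mulC subrr mxtrace_scalar.
move/esym/eqP; rewrite mulrn_eq0 mxrank_eq0 (negbTE nz) /=.
by move/eqP.
Qed.
End MatrixFacts.

(** * Adjoint matrices, the Killing form and weights *)

Section LieBasics.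
Variables (K : numFieldType) (g : vectType K) (br : g -> g -> g).
Hypothesis hbr : lie_bracket br.
Implicit Types x y z v : g.

Lemma br_linr x : linear (br x). Proof. by case: hbr. Qed.
Lemma br_linl y : linear (br^~ y). Proof. by case: hbr. Qed.
Lemma brxx x : br x x = 0. Proof. by case: hbr. Qed.

Lemma brDr x y z : br x (y + z) = br x y + br x z.
Proof. by have := br_linr x 1 y z; rewrite !scale1r. Qed.
Lemma brDl x y z : br (x + y) z = br x z + br y z.
Proof. by have := br_linl z 1 x y; rewrite /= !scale1r. Qed.
Lemma brx0 x : br x 0 = 0.
Proof. by apply: (addrI (br x 0)); rewrite -brDr !addr0. Qed.
Lemma br0x x : br 0 x = 0.
Proof. by apply: (addrI (br 0 x)); rewrite -brDl !addr0. Qed.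
Lemma brZr c x y : br x (c *: y) = c *: br x y.
Proof. by have := br_linr x c y 0; rewrite !addr0 brx0 addr0. Qed.
Lemma brZl c x y : br (c *: x) y = c *: br x y.
Proof. by have := br_linl y c x 0; rewrite /= !addr0 br0x addr0. Qed.
Lemma brNr x y : br x (- y) = - br x y.
Proof. by rewrite -scaleN1r brZr scaleN1r. Qed.
Lemma brNl x y : br (- x) y = - br x y.
Proof. by rewrite -scaleN1r brZl scaleN1r. Qed.
Lemma brC x y : br x y = - br y x.
Proof.
apply/eqP; rewrite -addr_eq0; have := brxx (x + y).
by rewrite brDl !brDr !brxx add0r addr0 => ->.
Qed.
Lemma br_sumr x (I : Type) (s : seq I) (p : pred I) (f : I -> g) :
  br x (\sum_(k <- s | p k) f k) = \sum_(k <- s | p k) br x (f k).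
Proof. by apply: (big_morph (br x) (brDr x) (brx0 x)). Qed.
Lemma br_suml x (I : Type) (s : seq I) (p : pred I) (f : I -> g) :
  br (\sum_(k <- s | p k) f k) x = \sum_(k <- s | p k) br (f k) x.
Proof. by apply: (big_morph (br^~ x) (fun y z => brDl y z x) (br0x x)). Qed.

Lemma jacobi x y z : br x (br y z) = br (br x y) z + br y (br x z).
Proof.
case: hbr => _ _ _ /(_ x y z) /eqP; rewrite -addrA addr_eq0 => /eqP ->.
by rewrite opprD addrC -brC -brNr -brC.
Qed.

(** Matrices act on rows from the right, which reverses the commutator in [admx_br]. *)
Definition admx x : 'M[K]_(dim g) := \matrix_k v2r (br x (r2v (delta_mx 0 k))).

Lemma v2r_ad x y : v2r (br x y) = v2r y *m admx x.
Proof.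
rewrite -{1}[y]v2rK [v2r y]row_sum_delta !linear_sum br_sumr linear_sum.
rewrite mulmx_suml; apply: eq_bigr => k _.
by rewrite !linearZ /= brZr linearZ /= -scalemxAl -rowE rowK.
Qed.

Lemma admx_ext (A B : 'M[K]_(dim g)) :
  (forall x, v2r x *m A = v2r x *m B) -> A = B.
Proof.
move=> AB; apply/row_matrixP => k; rewrite !rowE.
by have := AB (r2v (delta_mx 0 k)); rewrite r2vK.
Qed.

Lemma admxD c x y : admx (c *: x + y) = c *: admx x + admx y.
Proof.
apply: admx_ext => z; rewrite -v2r_ad brDl brZl linearP /= mulmxDr -scalemxAr.
by rewrite !v2r_ad.
Qed.

Lemma admxZ c x : admx (c *: x) = c *: admx x.
Proof.
by apply: admx_ext => z; rewrite -v2r_ad brZl linearZ /= -scalemxAr v2r_ad.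
Qed.

Lemma admx0 : admx 0 = 0.
Proof. by apply: admx_ext => z; rewrite -v2r_ad br0x linear0 mulmx0. Qed.

Lemma admx_br x y : admx (br x y) = admx y *m admx x - admx x *m admx y.
Proof.
apply: admx_ext => z; rewrite mulmxBr !mulmxA -!v2r_ad -linearB /=.
by congr v2r; rewrite (jacobi x) addrK.
Qed.

Definition killing x y : K := \tr (admx x *m admx y).

Lemma killingC x y : killing x y = killing y x.
Proof. exact: mxtrace_mulC. Qed.

Lemma killing_linl c x y z : killing (c *: x + y) z = c * killing x z + killing y z.
Proof. by rewrite /killing admxD mulmxDl -scalemxAl mxtraceD mxtraceZ. Qed.

Lemma killing_linr z c x y : killing z (c *: x + y) = c * killing z x + killing z y.
Proof. by rewrite killingC killing_linl !(killingC z). Qed.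

Lemma killing_br x y z : killing (br x y) z = killing x (br y z).
Proof.
rewrite /killing !admx_br mulmxBl mulmxBr !raddfB /= !mulmxA; congr (_ - _).
by rewrite [RHS]mxtrace_mulC mulmxA.
Qed.

Lemma simple_center x : simple_lie br -> (forall y, br x y = 0) -> x = 0.
Proof.
case=> -[y [z yz]] ideal x0; have [|E|E] := ideal <[x]>%VS.
- move=> y1 y2 /vlineP [c ->]; rewrite brZr brC x0 oppr0 scaler0; exact: mem0v.
- by have := memv_line x; rewrite E memv0 => /eqP.
- have /vlineP [c Ey] : y \in <[x]>%VS by rewrite E memvf.
  by move: yz; rewrite Ey brZl x0 scaler0 eqxx.
Qed.

(* The radical of the Killing form is an ideal. *)
Lemma simple_killing0 x : simple_lie br -> x != 0 ->
  (forall y, killing x y = 0) -> forall y z, killing y z = 0.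
Proof.
case=> _ ideal x0 kx.
pose e k : g := r2v (delta_mx 0 k).
pose f y : 'rV[K]_(dim g) := \row_k killing y (e k).
have lf : linear f by move=> c y z; apply/rowP => k; rewrite !mxE killing_linl.
pose fl : {linear g -> 'rV[K]_(dim g)} :=
  HB.pack f (GRing.isLinear.Build _ _ _ _ f lf).
have kerP y : reflect (forall z, killing y z = 0) (y \in lker (linfun fl)).
  rewrite memv_ker lfunE; apply: (iffP eqP) => [/rowP yE z|y0]; last first.
    by apply/rowP => k; rewrite !mxE y0.
  rewrite -[z]v2rK [v2r z]row_sum_delta linear_sum.
  elim/big_rec: _ => [|k z' _ IH].
    by rewrite /killing admx0 mulmx0 mxtrace0.
  by rewrite linearZ /= killing_linr IH addr0; have := yE k; rewrite !mxE => ->; rewrite mulr0.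
have [|E|E] := ideal (lker (linfun fl)).
- move=> y z /kerP z0; apply/kerP => t; rewrite brC -scaleN1r -[_ *: _]addr0.
  rewrite killing_linl killing_br z0 mulr0 add0r.
  by rewrite /killing admx0 mul0mx mxtrace0.
- by move/kerP: kx; rewrite E memv0 (negbTE x0).
- by move=> y z; have := memvf y; rewrite -E => /kerP ->.
Qed.

Lemma ad_diag y : ad_diagonalizable br y -> diagonalizable (admx y).
Proof.
case=> b bB bE; have sb : size b == dim g.
  by rewrite -(size_basis (bB : basis_of _ (in_tuple b))) dimvf.
pose t := Tuple sb; have Ht k : exists c, br y (tnth t k) = c *: tnth t k.
  by apply: bE; apply: mem_tnth.
have /fin_all_exists [c Hc] := Ht.
pose P : 'M[K]_(dim g) := \matrix_k v2r (tnth t k).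
have fP : row_free P.
  apply: inj_row_free => v vP; have /freeP fr : free t by apply: basis_free bB.
  apply/rowP => k; rewrite mxE; apply: (fr (fun k => v 0 k)).
  apply: v2r_inj; rewrite linear0 -vP linear_sum mulmx_sum_row.
  by apply: eq_bigr => l _; rewrite linearZ rowK /= (tnth_nth 0).
exists P; first by rewrite -row_free_unit.
apply/diagonalizable_forPex; exists (\row_k c k); apply: simmxW => //.
apply/row_matrixP => k; rewrite row_mul rowK -v2r_ad Hc linearZ /=.
by apply/rowP => l; rewrite mul_diag_mx !mxE.
Qed.

Variable h : {vspace g}.
Hypothesis hh : cartan_subalgebra br h.

Definition weight (l : hdual h) x : Prop :=
  forall y : subvs_of h, br (vsval y) x = l y *: x.

Lemma cartan_weight0 x : weight 0 x <-> x \in h.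
Proof.
case: hh => ab cent _; split=> [x0|xh y].
  apply: cent => y yh; have := x0 (Subvs yh); rewrite /= => ->.
  by rewrite lfunE /= scale0r.
by rewrite lfunE /= scale0r ab // subvsP.
Qed.

Lemma weight_br l m x y : weight l x -> weight m y -> weight (l + m) (br x y).
Proof.
move=> wx wy z; rewrite jacobi wx wy brZl brZr -scalerDl.
by rewrite lfunE.
Qed.

Lemma weightZ l c x : weight l x -> weight l (c *: x).
Proof. by move=> wx y; rewrite brZr wx !scalerA mulrC. Qed.

(** The commuting matrices of a basis of [h] are diagonalized by one [P]. Its rows give the weight
    vectors, and the diagonal entries, linear in [y], are the weights; the trace of a square then
    gives the Killing norm. *)
Lemma weight_basis : exists (e : 'I_(dim g) -> g) (l : 'I_(dim g) -> hdual h),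
  [/\ forall k, weight (l k) (e k),
      forall x, exists c : 'I_(dim g) -> K, x = \sum_k c k *: e k,
      forall c : 'I_(dim g) -> K, \sum_k c k *: e k = 0 -> forall k, c k = 0
    & forall y : subvs_of h, killing (vsval y) (vsval y) = \sum_k l k y ^+ 2].
Proof.
case: hh => ab cent dg.
have [P Pu /allP Pd] : codiagonalizable [seq admx y | y <- vbasis h].
  apply/codiagonalizableP; split=> [A B /mapP [x xb ->] /mapP [y yb ->]|A].
    rewrite /comm_mx; apply/eqP; rewrite -subr_eq0 -admx_br ab ?vbasis_mem //.
    by rewrite admx0.
  by move=> /mapP [x xb ->]; apply/ad_diag/dg/vbasis_mem.
pose Dm y := P *m admx y *m invmx P.
have DmP c x y : Dm (c *: x + y) = c *: Dm x + Dm y.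
  by rewrite /Dm admxD mulmxDr mulmxDl -scalemxAr -scalemxAl.
have Dd y : y \in h -> is_diag_mx (Dm y).
  move=> yh; rewrite (coord_vbasis yh).
  elim/big_ind: _ => [|x z dx dz|k _].
  - by rewrite /Dm admx0 mulmx0 mul0mx mx0_is_diag.
  - by rewrite -[x]scale1r DmP scale1r; apply/is_diag_mxP => p q pq;
       rewrite mxE (is_diag_mxP dx) // (is_diag_mxP dz) // addr0.
  have bk : (vbasis h)`_k \in vbasis h by apply: mem_nth; rewrite size_tuple.
  have : is_diag_mx (conjmx P (admx (vbasis h)`_k)) := Pd _ (map_f admx bk).
  rewrite (conjumx _ Pu).
  move=> /is_diag_mxP dk; apply/is_diag_mxP => p q pq.
  by rewrite /Dm admxZ -scalemxAr -scalemxAl mxE dk // mulr0.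
pose lf k (y : subvs_of h) : K^o := Dm (vsval y) k k.
have lin k : linear (lf k) by move=> c x y; rewrite /lf linearP DmP !mxE.
pose lk k : {linear subvs_of h -> K^o} :=
  HB.pack (lf k) (GRing.isLinear.Build _ _ _ _ (lf k) (lin k)).
exists (fun k => r2v (row k P)), (fun k => linfun (lk k)).
have lE k (y : subvs_of h) : linfun (lk k) y = Dm (vsval y) k k by rewrite lfunE.
have DE (y : subvs_of h) : Dm (vsval y) = diag_mx (\row_k linfun (lk k) y).
  apply/matrixP => p q; rewrite [RHS]mxE [X in X *+ _]mxE lE.
  case: eqVneq => [->|pq] /=; first by rewrite mulr1n.
  have /is_diag_mxP dy := Dd _ (subvsP y); by rewrite dy.
split=> [k y|x|c c0 k|y].
- apply: v2r_inj; rewrite v2r_ad linearZ /= r2vK -row_mul.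
  have -> : P *m admx (vsval y) = Dm (vsval y) *m P by rewrite mulmxKV.
  by rewrite DE; apply/rowP => l; rewrite mul_diag_mx !mxE.
- exists (fun k => (v2r x *m invmx P) 0 k); apply: v2r_inj.
  rewrite -{1}[v2r x](mulmxKV Pu) linear_sum mulmx_sum_row.
  by apply: eq_bigr => k _; rewrite linearZ /= r2vK.
- have : v2r (\sum_k c k *: r2v (row k P)) = (\row_k c k) *m P.
    rewrite linear_sum mulmx_sum_row; apply: eq_bigr => l _.
    by rewrite linearZ /= r2vK mxE.
  rewrite c0 linear0 => /(congr1 (mulmx^~ (invmx P))).
  by rewrite mul0mx mulmxK // => /rowP /(_ k); rewrite !mxE.
- rewrite /killing; have -> : admx (vsval y) *m admx (vsval y) =
      invmx P *m (Dm (vsval y) *m Dm (vsval y) *m P).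
    by rewrite /Dm !mulmxA mulVmx // mul1mx !(mulmxKV Pu).
  rewrite mxtrace_mulC mulmxK // {1}DE mul_diag_mx /mxtrace.
  by apply: eq_bigr => k _; rewrite mxE [X in X * _]mxE !lE expr2.
Qed.

Lemma weight_neg_br l x y : weight l x -> weight (- l) y -> br x y \in h.
Proof.
by move=> wx wy; apply/cartan_weight0; rewrite -(subrr l); apply: weight_br.
Qed.

Lemma weightN l x y : weight l x -> weight (- l) y ->
  forall z : subvs_of h, killing (br (vsval z) x) y = l z * killing x y.
Proof.
by move=> wx wy z; rewrite wx -[_ *: x]addr0 killing_linl /killing admx0 mul0mx
  mxtrace0 addr0.
Qed.

Hypothesis hsimple : simple_lie br.

(* The Killing form pairs [x] only with weight [-l], and there
   [l z * killing x y = killing z (br x y)]. *)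
Lemma killing_degenerate l x : l != 0 -> weight l x ->
  (forall y, weight (- l) y -> br x y = 0) -> forall y, killing x y = 0.
Proof.
move=> l0 wx x0; have [e [m [we span _ _]]] := weight_basis.
have key k : killing x (e k) = 0.
  have [mk|mk] := eqVneq (m k) (- l); last first.
    have [z Ez] : exists z : subvs_of h, (l + m k) z != 0.
      have [//|nz] := EM (exists z : subvs_of h, (l + m k) z != 0).
      case/eqP: mk; apply/eqP; rewrite -addr_eq0 addrC; apply/eqP/lfunP => z.
      rewrite [RHS]lfunE /=; apply/eqP/negPn/negP => zz; apply: nz.
      by exists z.
    apply: (mulfI Ez); rewrite mulr0 lfunE /= mulrDl.
    have := killing_br x (vsval z) (e k).
    rewrite brC wx we -scaleNr -[_ *: x]addr0 killing_linl -[_ *: e k]addr0.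
    rewrite killing_linr /killing admx0 mul0mx mulmx0 mxtrace0 !addr0 => <-.
    by rewrite mulNr addrN.
  have [z Ez] : exists z : subvs_of h, l z != 0.
    have [//|nz] := EM (exists z : subvs_of h, l z != 0).
    case/eqP: l0; apply/lfunP => z; rewrite [RHS]lfunE /=.
    by apply/eqP/negPn/negP => zz; apply: nz; exists z.
  apply: (mulfI Ez); rewrite mulr0.
  have wk : weight (- l) (e k) by rewrite -mk.
  by rewrite -(weightN wx wk) killing_br x0 // /killing admx0 mulmx0 mxtrace0.
move=> y; have [c ->] := span y; elim/big_rec: _ => [|k z _ IH].
  by rewrite /killing admx0 mulmx0 mxtrace0.
by rewrite killing_linr key IH mulr0 addr0.
Qed.

(** Since [l] is defined on the subtype of [h], the bracket is named by [H], the unique element with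
    that value ([weight_neg_br]). *)
Definition has_coroot l := exists x y,
  [/\ weight l x, weight (- l) y & forall H : subvs_of h, vsval H = br x y -> l H != 0].

(** Each weight takes at [H] an eigenvalue of its adjoint matrix, so [H] acts by 0 and is
    central. *)
Lemma cartan_diag0 (H : subvs_of h) :
  (forall c, eigenvalue (admx (vsval H)) c -> c = 0) -> vsval H = 0.
Proof.
move=> H0; apply: simple_center => // y.
have [e [m [we span indep _]]] := weight_basis.
have [c ->] := span y; rewrite br_sumr big1 // => k _; rewrite brZr we.
suff -> : m k H = 0 by rewrite scale0r scaler0.
apply: H0; apply/eigenvalueP; exists (v2r (e k)).
  by rewrite -v2r_ad we linearZ.
rewrite -(linear0 v2r) (can_eq v2rK); apply: contraTneq (oner_neq0 K) => ek0.
rewrite negbK; apply/eqP; rewrite -(indep (fun j => (j == k)%:R) _ k) ?eqxx //.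
by rewrite (bigD1 k) //= ek0 scaler0 add0r big1 // => j /negbTE ->; rewrite scale0r.
Qed.

Lemma no_coroot_br l x y : ~ has_coroot l -> weight l x -> weight (- l) y ->
  br x y = 0.
Proof.
move=> nc wx wy; have Hh := weight_neg_br wx wy.
pose H := Subvs Hh; have EH : vsval H = br x y by [].
have lH : l H = 0.
  apply/eqP/negPn/negP => lH; apply: nc; exists x, y; split=> // H'.
  by rewrite -EH => /subvs_inj ->.
rewrite -EH; apply: cartan_diag0 => c; rewrite EH admx_br.
apply: commutator_eigenvalue0 (erefl _) _ _; rewrite -admx_br -EH.
  apply/eqP; rewrite -subr_eq0 -admx_br brC wy lfunE /= lH oppr0 scale0r oppr0.
  by rewrite admx0.
by apply/eqP; rewrite -subr_eq0 -admx_br brC wx lH scale0r oppr0 admx0.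
Qed.

Definition triple (l : hdual h) (e f : g) (H : subvs_of h) : Prop :=
  [/\ weight l e, weight (- l) f, br e f = vsval H & l H = 2].

Lemma has_coroot_triple l : has_coroot l -> exists e f H, triple l e f H.
Proof.
case=> x [y [wx wy nz]]; have Hh := weight_neg_br wx wy.
have lH := nz (Subvs Hh) (erefl _).
exists x, (2 / l (Subvs Hh) *: y), (2 / l (Subvs Hh) *: Subvs Hh); split=> //.
- exact: weightZ.
- by rewrite brZr linearZ.
- by rewrite linearZ /= [_ *: _]divfK.
Qed.

Lemma triple_swap l e f H : triple l e f H -> triple (- l) f e (- H).
Proof.
case=> we wf ef lH; split=> //; first by rewrite opprK.
  by rewrite brC ef linearN.
by rewrite lfunE /= linearN /= opprK.
Qed.

(** Otherwise brackets of weight 0 between opposite weight vectors vanish, so all brackets lie in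
    the sum [N] of the nonzero weight spaces, an ideal. Then [N] is everything; but it meets [h]
    only in 0, so [h] is 0, no nonzero weight exists and [N] is 0. *)
Lemma exists_coroot : exists l, has_coroot l.
Proof.
apply: contrapT => no.
have [e [m [we span indep _]]] := weight_basis.
have [[x [y xy]] ideal] := hsimple.
pose N := (\sum_(k | m k != 0%R) <[e k]>)%VS.
have inN z l : weight l z -> l != 0 -> z \in N.
  move=> wz l0; have [c Ec] := span z; rewrite Ec; apply: memv_suml => k _.
  have [->|ck] := eqVneq (c k) 0; first by rewrite scale0r mem0v.
  suff mk : m k = l.
    by apply: memvZ; apply: (subvP (sumv_sup k _ (subvv _))); rewrite ?mk ?memv_line.
  apply/lfunP => H; have := wz H; rewrite Ec br_sumr scaler_sumr => /eqP.
  rewrite -subr_eq0 -sumrB (eq_bigr (fun j => (c j * (m j H - l H)) *: e j)); last first.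
    by move=> j _; rewrite brZr we !scalerA -scalerBl mulrBr [l H * _]mulrC.
  move/eqP => /indep /(_ k) /eqP; rewrite mulf_eq0 (negbTE ck) /= subr_eq0.
  by move/eqP.
have brN a b : br a b \in N.
  have [c ->] := span a; have [c' ->] := span b.
  rewrite br_suml; apply: memv_suml => k _; rewrite br_sumr; apply: memv_suml => j _.
  rewrite brZl brZr; apply: memvZ; apply: memvZ.
  have [mkj|mkj] := eqVneq (m k + m j) 0; last exact: inN (weight_br (we k) (we j)) mkj.
  rewrite (@no_coroot_br (m k)) ?mem0v //; first by move=> ck; apply: no; exists (m k).
  by move/eqP: mkj; rewrite addr_eq0 => /eqP ->; rewrite opprK.
have [|E|E] := ideal N; first by move=> a b _; apply: brN.
  by have := brN x y; rewrite E memv0 (negbTE xy).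
have h0 H : H \in h -> H = 0.
  move=> Hh; have : H \in N by rewrite E memvf.
  case/memv_sumP => w wN Ew; rewrite Ew big1 // => k mk.
  have /fin_all_exists [c Hc] : forall k : 'I_(dim g), exists c, m k != 0 -> w k = c *: e k.
    move=> j; have [mj|mj] := eqVneq (m j) 0; first by exists 0.
    by have /vlineP [c Ec] := wN j mj; exists c.
  have ck (z : subvs_of h) : c k * m k z = 0.
    pose c' j := if m j == 0 then 0 else c j * m j z.
    have : c' k = 0; last by rewrite /c' (negbTE mk).
    apply: indep; have : br (vsval z) H = 0.
      by case: hh => ab _ _; apply: ab => //; apply: subvsP.
    rewrite Ew br_sumr => E0; rewrite -[RHS]E0 [RHS]big_mkcond /=; apply: eq_bigr => j _.
    rewrite /c'; case: eqVneq => [|mj] /=; first by rewrite scale0r.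
    by rewrite Hc // brZr we scalerA.
  rewrite Hc //; have [->|nc] := eqVneq (c k) 0; first by rewrite scale0r.
  case/eqP: mk; apply/lfunP => z; rewrite [RHS]lfunE /=; apply/eqP.
  by have /eqP := ck z; rewrite mulf_eq0 (negbTE nc).
have m0 k : m k = 0.
  apply/lfunP => z; have -> : z = 0 by apply/val_inj/h0/subvsP.
  by rewrite !linear0.
move: xy; suff -> : br x y = 0 by rewrite eqxx.
apply/eqP; rewrite -memv0; have := brN x y; rewrite /N big_pred0 // => k.
by rewrite m0 eqxx.
Qed.

(** * Representations of sl2 *)

Definition sl2 (e f H : g) : Prop :=
  [/\ br e f = H, br H e = 2 *: e & br H f = (-2) *: f].

Lemma sl2_swap e f H : sl2 e f H -> sl2 f e (- H).
Proof.
case=> ef He Hf; split; first by rewrite brC ef.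
  by rewrite brNl Hf scaleNr opprK.
by rewrite brNl He scaleNr.
Qed.

Lemma triple_sl2 l e f H : triple l e f H -> sl2 e f (vsval H).
Proof.
case=> we wf ef lH; split=> //; first by rewrite we lH.
by rewrite wf lfunE /= lH.
Qed.

Lemma iter_weight_shift e H (c t : K) v : br H e = c *: e -> br H v = t *: v ->
  forall m, br H (iter m (br e) v) = (t + c *+ m) *: iter m (br e) v.
Proof.
move=> He Hv; elim=> [|m IH] /=; first by rewrite addr0.
rewrite jacobi He IH brZl brZr -scalerDl; congr (_ *: _).
by rewrite mulrS addrCA addrA addrC.
Qed.

(* The nonzero terms are eigenvectors with distinct eigenvalues. *)
Lemma iter_shift_stops e H (c t : K) v : c != 0 ->
  br H e = c *: e -> br H v = t *: v -> exists m, iter m (br e) v = 0.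
Proof.
move=> c0 He Hv; apply: contrapT => no.
have nz m : iter m (br e) v != 0 by apply/negP => /eqP E; apply: no; exists m.
have shift := iter_weight_shift He Hv.
pose n := dim g; pose rs := [seq t + c *+ m | m <- iota 0 n.+1].
have p0 : char_poly (admx H) != 0 by apply: monic_neq0; apply: char_poly_monic.
have := max_poly_roots p0 (_ : all (root _) rs) (_ : uniq rs).
rewrite size_char_poly size_map size_iota ltnn => /(_ _ _)/negP [] //.
  apply/allP => _ /mapP [m _ ->]; rewrite -eigenvalue_root_char.
  apply/eigenvalueP; exists (v2r (iter m (br e) v)).
    by rewrite -v2r_ad shift linearZ.
  by rewrite -(linear0 v2r) (can_eq v2rK).
rewrite map_inj_uniq ?iota_uniq // => m m' /addrI; rewrite -!(mulr_natr c).
by move/(mulfI c0)/eqP; rewrite eqr_nat => /eqP.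
Qed.

Lemma iter_last e v : v != 0 -> (exists m, iter m (br e) v = 0) ->
  exists p, iter p (br e) v != 0 /\ br e (iter p (br e) v) = 0.
Proof.
move=> v0 [m]; elim: m => [E|m IH E]; first by rewrite /= in E; rewrite E eqxx in v0.
by have [/IH //|nz] := eqVneq (iter m (br e) v) 0; exists m.
Qed.

Lemma sl2_highest_step e f H t v : sl2 e f H -> br H v = t *: v -> br e v = 0 ->
  forall m, br e (iter m.+1 (br f) v) =
    (m.+1%:R * (t - m%:R)) *: iter m (br f) v.
Proof.
case=> ef He Hf Hv ev; elim=> [|m IH].
  by rewrite /= jacobi ef ev brx0 addr0 Hv mul1r subr0.
rewrite [iter m.+2 _ _]iterS jacobi ef IH (iter_weight_shift Hf Hv).
rewrite brZr -iterS -scalerDl; congr (_ *: _).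
rewrite -(mulr_natr (-2)) -[m.+2]addn2 -[m.+1]addn1 !natrD; ring.
Qed.

(** If [N] is the last step at which the [f]-string is nonzero, [sl2_highest_step] at [N] forces
    [t = N]. *)
Lemma sl2_highest e f H t v : sl2 e f H -> v != 0 -> br H v = t *: v ->
  br e v = 0 ->
  exists N, t = N%:R /\ forall m, (m <= N)%N -> iter m (br f) v != 0.
Proof.
move=> s v0 Hv ev; have [_ _ Hf] := s.
have two0 : (-2 : K) != 0 by rewrite oppr_eq0 pnatr_eq0.
have [N [nz fN]] := iter_last v0 (iter_shift_stops two0 Hf Hv).
exists N; split=> [|m mN].
  have := sl2_highest_step s Hv ev N; rewrite /= fN brx0 => /esym /eqP.
  by rewrite scaler_eq0 (negbTE nz) orbF mulf_eq0 pnatr_eq0 /= subr_eq0 => /eqP.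
apply: contraNneq nz => E; rewrite -(subnK mN) iterD E.
by apply/eqP; elim: (N - m)%N => //= k ->; rewrite brx0.
Qed.

Lemma sl2_raise e f H t v : sl2 e f H -> v != 0 -> br H v = t *: v ->
  exists p N, t + 2 *+ p = N%:R /\
    forall m, (m <= N)%N -> iter m (br f) (iter p (br e) v) != 0.
Proof.
move=> s v0 Hv; have [_ He _] := s.
have two0 : (2 : K) != 0 by rewrite pnatr_eq0.
have [p [nz ep]] := iter_last v0 (iter_shift_stops two0 He Hv).
have Hp := iter_weight_shift He Hv p.
by have [N [E HN]] := sl2_highest s nz Hp ep; exists p, N.
Qed.

Lemma weight_iter l m e x n : weight l e -> weight m x ->
  weight (m + l *+ n) (iter n (br e) x).
Proof.
move=> we wx; elim: n => [|n IH] /=; first by rewrite addr0.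
by rewrite mulrS addrCA; apply: weight_br.
Qed.

Lemma triple_int l e f H m x : triple l e f H -> weight m x -> x != 0 ->
  exists z : int, m H = z%:~R.
Proof.
move=> tr wx x0; have [p [N [E _]]] := sl2_raise (triple_sl2 tr) x0 (wx H).
exists (N%:Z - 2 *+ p).
by rewrite -[LHS](addrK (2 *+ p)) E rmorphB /= rmorphMn /= -pmulrn.
Qed.

Lemma triple_refl_pos l e f H m x n : triple l e f H -> weight m x -> x != 0 ->
  m H = n%:R -> exists2 x', x' != 0 & weight (m - m H *: l) x'.
Proof.
move=> tr wx x0 mH; have [p [N [E nz]]] := sl2_raise (triple_sl2 tr) x0 (wx H).
have [we wf _ _] := tr.
have EN : (n + p.*2)%N = N.
  by apply/eqP; rewrite -(eqr_nat K) -E mH natrD -muln2 natrM mulr_natl.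
(* From weight [m + p l], [n + p] lowerings lead to [m - n l], within the [N = n + 2 p] steps
   available. *)
exists (iter (n + p) (br f) (iter p (br e) x)).
  by apply: nz; rewrite -EN leq_add2l -addnn leq_addr.
have := weight_iter (n + p) wf (weight_iter p we wx).
congr (weight _ _); rewrite mH scaler_nat mulNrn mulrnDr opprD.
by rewrite [- (l *+ n) + _]addrC addrA addrK.
Qed.

Lemma triple_refl l e f H m x : triple l e f H -> weight m x -> x != 0 ->
  exists2 x', x' != 0 & weight (m - m H *: l) x'.
Proof.
move=> tr wx x0; have [z mH] := triple_int tr wx x0.
case: z mH => n mH; first exact: (triple_refl_pos tr wx x0 mH).
have := triple_refl_pos (n := n.+1) (triple_swap tr) wx x0.
rewrite linearN /= mH NegzE mulrNz opprK => /(_ (erefl _)) [x' nz wx'].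
by exists x' => //; move: wx'; rewrite scalerN scaleNr.
Qed.

(** If [f] killed [x], then [x] would be a highest vector of the swapped triple, making [- m H] a
    natural number. *)
Lemma triple_string l e f H m x : triple l e f H -> weight m x -> x != 0 ->
  0 < m H -> exists2 x', x' != 0 & weight (m - l) x'.
Proof.
move=> tr wx x0 mH; have [we wf _ _] := tr.
exists (br f x); last by rewrite addrC; apply: weight_br.
apply/negP => /eqP fx.
have HN : br (- vsval H) x = - m H *: x by rewrite brNl wx scaleNr.
have [N [E _]] := sl2_highest (sl2_swap (triple_sl2 tr)) x0 HN fx.
by have := ler0n K N; rewrite -E oppr_ge0 => /(lt_le_trans mH); rewrite ltxx.
Qed.

Lemma lfun_mulrn (l : hdual h) n H : (l *+ n) H = l H *+ n.
Proof.
by elim: n => [|n IH]; rewrite ?mulr0n ?zero_lfunE // !mulrS add_lfunE IH.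
Qed.

(* Lowering a top vector of weight [k l] by [k] steps lands in the Cartan
   subalgebra, where two more lowering steps give 0; but a vector of
   [H]-weight [2 k] survives [2 k >= k + 2] steps. *)
Lemma triple_reduced l e f H k x : triple l e f H -> weight (l *+ k) x ->
  x != 0 -> (k < 2)%N.
Proof.
move=> tr wx x0; rewrite ltnNge; apply/negP => k2.
have [we wf _ lH] := tr; have s := triple_sl2 tr; have [_ He _] := s.
have two0 : (2 : K) != 0 by rewrite pnatr_eq0.
have [p [nz ep]] := iter_last x0 (iter_shift_stops two0 He (wx H)).
set y := iter p _ _ in nz ep.
have wy : weight (l *+ (k + p)) y by rewrite mulrnDr; apply: weight_iter.
have [N [EN HN]] := sl2_highest s nz (wy H) ep.
have {}EN : ((k + p).*2)%N = N.
  by apply/eqP; rewrite -(eqr_nat K) -EN lfun_mulrn lH -muln2 natrM mulr_natl.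
have wh : iter (k + p) (br f) y \in h.
  apply/cartan_weight0; have := weight_iter (k + p) wf wy.
  by rewrite mulNrn subrr.
have := HN (k + p).+2; rewrite -EN -addnn -addn2 leq_add2l.
rewrite (leq_trans k2) ?leq_addr // => /(_ isT) /eqP; apply => /=.
have /= := wf (Subvs wh); rewrite addn2 /= [br f (iter _ _ _)]brC => ->.
by rewrite brNr brZr brxx scaler0 oppr0.
Qed.

(** Without a coroot the Killing form vanishes. The [H] of any existing triple has integral weights
    whose squares sum to 0, so it acts by 0; then [e] is 0, hence so is [H], against value 2. *)
Lemma root_triple l x : l != 0 -> weight l x -> x != 0 ->
  exists e f H, triple l e f H.
Proof.
move=> l0 wx x0; apply: has_coroot_triple; apply: contrapT => no.
have k0 := killing_degenerate l0 wx (fun y => no_coroot_br no wx).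
have kill0 := simple_killing0 hsimple x0 k0.
have [m /has_coroot_triple [e [f [H tr]]]] := exists_coroot.
have [b [w [wb span indep kH]]] := weight_basis.
have b0 k : b k != 0.
  apply: contraTneq (oner_neq0 K) => ek0; rewrite negbK; apply/eqP.
  rewrite -(indep (fun j => (j == k)%:R) _ k) ?eqxx //.
  by rewrite (bigD1 k) //= ek0 scaler0 add0r big1 // => j /negbTE ->; rewrite scale0r.
have wH k : w k H = 0.
  apply/eqP; rewrite -sqrf_eq0; apply/eqP.
  have := kill0 (vsval H) (vsval H); rewrite kH => /psumr_eq0P; apply=> // j _.
  have [z ->] := triple_int tr (wb j) (b0 j).
  by rewrite -rmorphXn /= ler0z sqr_ge0.
have [we wf ef mH] := tr.
have e0 : e = 0.
  apply: (scalerI (_ : (2 : K) != 0)); first by rewrite pnatr_eq0.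
  rewrite scaler0 -mH -we; have [c ->] := span e.
  by rewrite br_sumr big1 // => k _; rewrite brZr wb wH scale0r scaler0.
have H0 : H = 0 by apply: val_inj; rewrite /= -ef e0 br0x.
by have := mH; rewrite H0 linear0 => /esym/eqP; rewrite pnatr_eq0.
Qed.
End LieBasics.

(** * The root system of a simple Lie algebra *)

Section RootsOfSimple.
Variables (R : realType) (g : vectType R[i]%C) (br : g -> g -> g).
Hypotheses (hbr : lie_bracket br) (hsimple : simple_lie br).
Variable h : {vspace g}.
Hypothesis hh : cartan_subalgebra br h.
Variable Delta : {fset hdual h}.
Hypothesis hDelta : forall a : hdual h, a \in Delta <-> is_root br a.
Variables (r : nat) (Pi : r.-tuple (hdual h)).
Hypothesis hPi : simple_roots Delta Pi.
Implicit Types (d : Delta) (j k : 'I_r).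

Lemma coefE (n : 'I_r -> int) (b : hdual h) j :
  b = \sum_k (n k)%:~R *: Pi`_k -> coef Pi b j = n j.
Proof.
move=> ->; have [_ fr _] := hPi.
rewrite /coef coord_sum_free // -(rmorph_int (real_complex R)) /=.
exact: intrKfloor.
Qed.

Lemma root_coords (b : hdual h) : b \in Delta -> exists n : 'I_r -> int,
  b = \sum_k (n k)%:~R *: Pi`_k /\
  ((forall k, 0 <= n k) \/ (forall k, n k <= 0)).
Proof.
have [_ _ H] := hPi; case/H => n [] E.
  exists (fun k => (n k)%:Z); split; last by left.
  by rewrite E; apply: eq_bigr => k _; rewrite -pmulrn scaler_nat.
exists (fun k => - (n k)%:Z); split; last by right => k; rewrite oppr_le0.
rewrite E -sumrN; apply: eq_bigr => k _.
by rewrite rmorphN /= -pmulrn scaleNr scaler_nat.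
Qed.

Definition coords d : 'rV[int]_r := \row_k coef Pi (val d) k.

Lemma coordsE d : val d = \sum_k (coords d 0 k)%:~R *: Pi`_k.
Proof.
have [n [E _]] := root_coords (valP d); rewrite {1}E.
by apply: eq_bigr => k _; rewrite mxE (coefE k E).
Qed.

Lemma coords_eq d (x : 'rV[int]_r) :
  val d = \sum_k (x 0 k)%:~R *: Pi`_k -> coords d = x.
Proof. by move=> E; apply/rowP => k; rewrite mxE (coefE k E). Qed.

Lemma simple_mem k : Pi`_k \in Delta.
Proof. by have [sub _ _] := hPi; apply: sub; apply: mem_nth; rewrite size_tuple. Qed.

Definition simple k : Delta := [` simple_mem k]%fset.

Lemma root_weight d : exists2 x, x != 0 & weight br (val d) x.
Proof. by have [_ []] := (hDelta (val d)).1 (valP d) => x; exists x. Qed.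

Lemma root_neq0 d : val d != 0.
Proof. by have [] := (hDelta (val d)).1 (valP d). Qed.

Lemma weight_root (m : hdual h) x :
  m != 0 -> x != 0 -> weight br m x -> exists d, val d = m.
Proof.
move=> m0 x0 wx; have mD : m \in Delta by apply/hDelta; split=> //; exists x.
by exists [` mD]%fset.
Qed.

Lemma coordsB d d' j (z : int) :
  val d' = val d - z%:~R *: Pi`_j -> coords d' = coords d - z *: delta_mx 0 j.
Proof.
move=> E; apply: coords_eq; rewrite E {1}coordsE.
rewrite [X in _ - X](_ : _ = \sum_k (z * (k == j)%:R)%:~R *: Pi`_k); last first.
  rewrite (bigD1 j) //= eqxx mulr1 big1 ?addr0 // => k /negbTE ->.
  by rewrite mulr0 scale0r.
rewrite -sumrB; apply: eq_bigr => k _; rewrite -scalerBl -rmorphB.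
by rewrite !mxE.
Qed.

Lemma root_system : exists C, based_roots coords simple C.
Proof.
have tr_ex d : exists e f H, triple br (val d) e f H.
  have [x x0 wx] := root_weight d.
  by apply: (root_triple hbr hh hsimple (root_neq0 d) wx x0).
have /fin_all_exists [e /fin_all_exists [f /fin_all_exists [H tr]]] :
  forall j, exists e f H, triple br Pi`_j e f H by move=> j; apply: (tr_ex (simple j)).
have int_ex d j : exists z : int, val d (H j) = z%:~R.
  have [x x0 wx] := root_weight d.
  exact: (triple_int hbr (tr j) wx x0).
have /fin_all_exists [c Hc] : forall k, exists z : 'I_r -> int,
    forall j, Pi`_k (H j) = (z j)%:~R.
  by move=> k; have /fin_all_exists [z Hz] := int_ex (simple k); exists z.
(* Cartan integers: values of simple roots at the [H] of the simple triples, integral by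
   [triple_int]. *)
pose C : 'M[int]_r := \matrix_(k, j) c k j.
have EH d j : val d (H j) = ((coords d *m C) 0 j)%:~R.
  rewrite coordsE sum_lfunE mxE rmorph_sum /=; apply: eq_bigr => k _.
  by rewrite scale_lfunE Hc [C k j]mxE intrM.
have val_simple j : val (simple j) = Pi`_j by [].
have coords_simple j : coords (simple j) = delta_mx 0 j.
  apply: coords_eq; rewrite (bigD1 j) //= mxE !eqxx big1 ?addr0 ?scale1r //.
  by move=> k /negbTE kj; rewrite mxE kj andbF scale0r.
exists C; split=> //.
- move=> d d' E; apply: val_inj; rewrite coordsE E -coordsE //.
- move=> d; have [n [E [n0|n0]]] := root_coords (valP d); [left|right] => k;
    by rewrite mxE (coefE k E).
- move=> d; apply: contraNneq (root_neq0 d) => E; rewrite coordsE E.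
  by apply/eqP; rewrite big1 // => k _; rewrite mxE scale0r.
- move=> j; have := EH (simple j) j; rewrite coords_simple -rowE mxE.
  have [_ _ _ ->] := tr j => /esym /eqP.
  by rewrite -[2]/(2%:~R) eqr_int => /eqP.
- move=> d j; have [x x0 wx] := root_weight d.
  have [x' x'0 wx'] := triple_refl hbr (tr j) wx x0.
  (* If it were 0, evaluating at [H j] would give [val d (H j)] equal to its double. *)
  have nz : val d - val d (H j) *: Pi`_j != 0.
    rewrite subr_eq0; apply: contra (root_neq0 d) => /eqP E.
    have := congr1 (fun l : hdual h => l (H j)) E; rewrite /= scale_lfunE.
    have [_ _ _ ->] := tr j => E2.
    rewrite E; suff -> : val d (H j) = 0 by rewrite scale0r.
    apply: (addrI (val d (H j))); rewrite addr0 [RHS]E2.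
    by rewrite [_ *: _]mulrDr mulr1.
  have [d' Ed'] := weight_root nz x'0 wx'.
  by exists d'; apply: coordsB; rewrite -EH.
- move=> d j m Ed.
  have [x x0 wx] := root_weight d.
  have E : val d = m%:~R *: Pi`_j.
    rewrite coordsE Ed (bigD1 j) //= !mxE !eqxx mulr1 big1 ?addr0 // => k /negbTE kj.
    by rewrite !mxE kj andbF mulr0 scale0r.
  have m0 : m != 0 by apply: contraNneq (root_neq0 d) => m0; rewrite E m0 scale0r.
  (* A negative multiple of the root is a positive multiple of its opposite, treated by the swapped
     triple. *)
  case: m m0 E {Ed} => n m0 E.
    have := triple_reduced hbr hh (k := n) (x := x) (tr j) _ x0.
    rewrite -scaler_nat pmulrn -E => /(_ wx); case: n m0 {E} => [|[|n]] //.
    by left.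
  have := triple_reduced hbr hh (k := n.+1) (x := x) (triple_swap hbr (tr j)) _ x0.
  rewrite -scaler_nat scalerN -scaleNr pmulrn -rmorphN -NegzE -E => /(_ wx).
  by case: n m0 {E} => [|n] //; right.
- move=> d j; rewrite -(ltr0z R[i]%C) -EH => dH dj.
  have [x x0 wx] := root_weight d.
  have [x' x'0 wx'] := triple_string hbr (tr j) wx x0 dH.
  have nz : val d - Pi`_j != 0.
    by rewrite subr_eq0; apply/eqP => E; apply: dj; apply: val_inj.
  have [d' Ed'] := weight_root nz x'0 wx'.
  by exists d'; rewrite -[delta_mx 0 j]scale1r; apply: coordsB; rewrite scale1r.
- move=> d; have [e' [f' [H' [we wf ef lH]]]] := tr_ex d.
  have nf : f' != 0.
    apply: contraTneq (oner_neq0 R[i]%C) => f0; rewrite negbK.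
    have H0 : H' = 0 by apply: val_inj; rewrite /= -ef f0 brx0.
    by have := lH; rewrite H0 linear0 => /esym /eqP; rewrite pnatr_eq0.
  have nz : - val d != 0 by rewrite oppr_eq0 root_neq0.
  have [d' Ed'] := weight_root nz nf wf.
  exists d'; apply: coords_eq; rewrite Ed' {1}coordsE -sumrN.
  by apply: eq_bigr => k _; rewrite -scaleNr -mulrNz [in RHS]mxE.
Qed.
End RootsOfSimple.

(** Substituting the square of the variable is injective on polynomials: clear denominators, undo
    the substitution, divide again. *)
Lemma tofrac_prod_sqr (Q : finType) (P : {poly int}) (n : Q -> nat)
    (t : {fraction {poly int}}) :
  t = tofrac 'X -> (forall q, (0 < n q)%N) ->
  tofrac (P \Po 'X^2) =
    \prod_q ((1 - (t ^+ 2) ^+ (n q).+1) / (1 - (t ^+ 2) ^+ n q)) ->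
  tofrac P = \prod_q ((1 - t ^+ (n q).+1) / (1 - t ^+ n q)).
Proof.
move=> Et; subst t => n0 EP; set t := tofrac 'X in EP *.
pose A m : {poly int} := 1 - 'X^m.
have A_neq0 m : (0 < m)%N -> A m != 0.
  by move=> m0; rewrite -oppr_eq0 opprB; apply: (monic_neq0 (monicXnsubC 1 m0)).
have EA m : 1 - t ^+ m = tofrac (A m) by rewrite tofracB tofrac1 tofracXn.
have EA2 m : 1 - (t ^+ 2) ^+ m = tofrac (A m \Po 'X^2).
  by rewrite /A comp_polyB comp_polyC comp_Xn_poly tofracB tofrac1 !tofracXn.
have A2_neq0 m : (0 < m)%N -> A m \Po 'X^2 != 0.
  by move=> m0; rewrite comp_poly_eq0 ?size_polyXn // A_neq0.
(* Forgets the body of [A], so that rewriting sees only these facts. *)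
move: A A_neq0 EA EA2 A2_neq0 => A A_neq0 EA EA2 A2_neq0.
rewrite (eq_bigr (fun q => tofrac (A (n q).+1) / tofrac (A (n q)))); last first.
  by move=> q _; rewrite !EA.
rewrite (eq_bigr (fun q => tofrac (A (n q).+1 \Po 'X^2) /
    tofrac (A (n q) \Po 'X^2))) in EP; last by move=> q _; rewrite !EA2.
have prodE (B : Q -> {poly int}) : \prod_q tofrac (B q) = tofrac (\prod_q B q).
  by rewrite rmorph_prod.
rewrite prodf_div !prodE in EP; rewrite prodf_div !prodE.
have nzB : tofrac (\prod_q A (n q)) != 0.
  by rewrite tofrac_eq0; apply/prodf_neq0 => q _; apply: A_neq0.
have nzB2 : tofrac (\prod_q (A (n q) \Po 'X^2)) != 0.
  by rewrite tofrac_eq0; apply/prodf_neq0 => q _; apply: A2_neq0.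
suff E : P * \prod_q A (n q) = \prod_q A (n q).+1.
  by rewrite -E tofracM (mulfK nzB).
have s2 : (1 < size ('X^2 : {poly int}))%N by rewrite size_polyXn.
apply: subr0_eq; apply/eqP; rewrite -(comp_poly_eq0 _ s2); apply/eqP.
rewrite comp_polyB comp_polyM !rmorph_prod; apply/eqP; rewrite subr_eq0.
by rewrite -tofrac_eq tofracM EP (divfK nzB2).
Qed.

Theorem theorem3p4 (R : realType) (g : vectType R[i]) (br : g -> g -> g)
    (hbr : lie_bracket br) (hsimple : simple_lie br)
    (h : {vspace g}) (hh : cartan_subalgebra br h)
    (Delta : {fset hdual h})
    (hDelta : forall a : hdual h, a \in Delta <-> is_root br a)
    (r : nat) (Pi : r.-tuple (hdual h)) (hPi : simple_roots Delta Pi)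
    (theta : hdual h) (htheta : highest_root Delta Pi theta)
    (i : 'I_r) (hi : coef Pi theta i = 1) :
  let t : {fraction {poly int}} := tofrac 'X in
  tofrac (ideal_poly (@root_le R (hdual h) Delta r Pi i)) =
  \prod_(c <- Delta1 Delta Pi i) ((1 - t ^ (ht Pi c + 1)) / (1 - t ^ ht Pi c)).
Proof.
move=> t; have [C hR] := root_system hbr hsimple hh hDelta hPi.
set co := coords _ in hR.
have coE (d : Delta) k : co d 0 k = coef Pi (val d) k by rewrite mxE.
(* The highest root minus [d] has nonnegative coordinates; opposite roots then give the lower
   bound. *)
have le1 (d : Delta) : co d 0 i <= 1.
  have [n En] := htheta.2 _ (valP d).
  rewrite -hi (coefE hPi (n := fun k => co d 0 k + (n k)%:Z)).
    by rewrite lerDl.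
  have -> : theta = val d + \sum_(j < r) Pi`_j *+ n j by rewrite -En addrC subrK.
  rewrite {1}(coordsE hPi d) -big_split; apply: eq_bigr => k _ /=.
  by rewrite intrD scalerDl -pmulrn scaler_nat.
have comin (d : Delta) : `|co d 0 i| <= 1.
  rewrite ler_norml le1 andbT; have [d' Ed'] := br_opp hR d.
  by have := le1 d'; rewrite Ed' mxE lerNl.
have mem1 (q : Delta1 Delta Pi i) : val q \in Delta /\ coef Pi (val q) i = 1.
  by have := valP q; rewrite !inE => /andP [? /eqP].
pose e (q : Delta1 Delta Pi i) : Delta := [` (mem1 q).1]%fset.
have val_e q : val (e q) = val q by [].
have e_inj : injective e by move=> q q' /(congr1 val) /= E; apply: val_inj.
have e_coef q : co (e q) 0 i = 1 by rewrite coE (mem1 q).2.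
have e_surj (d : Delta) : co d 0 i = 1 -> exists q, e q = d.
  rewrite coE => d1; have dD : val d \in Delta1 Delta Pi i.
    by rewrite !inE d1 eqxx andbT; apply: valP.
  by exists [` dD]%fset; apply: val_inj.
have leP q q' : reflect (forall k, co (e q) 0 k <= co (e q') 0 k)
    (@root_le R (hdual h) Delta r Pi i q q').
  rewrite /root_le; apply: (iffP (asboolP _)) => [[n En] k|le_qq'].
    rewrite (coE (e q')) (coefE hPi
      (n := fun k => co (e q) 0 k + (if k != i then (n k)%:Z else 0))).
      by rewrite lerDl; case: ifP.
    have -> : val (e q') = val (e q) + (val q' - val q) by rewrite addrC subrK.
    rewrite {1}(coordsE hPi (e q)) En [X in _ + X]big_mkcond -big_split.
    apply: eq_bigr => l _ /=; rewrite intrD scalerDl; congr (_ + _).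
    by case: ifP => _; rewrite ?scale0r // -pmulrn scaler_nat.
  (* These differences are nonnegative, so [absz] loses nothing; the [i]-th one is 0 as both roots
     have grade 1. *)
  exists (fun k : 'I_r => absz (co (e q') 0 k - co (e q) 0 k)%R).
  rewrite -!val_e !(coordsE hPi) -sumrB [RHS]big_mkcond; apply: eq_bigr => k _ /=.
  rewrite -scalerBl -rmorphB; case: eqVneq => [->|_] /=.
    by rewrite -/co !e_coef subrr scale0r.
  by rewrite -scaler_nat pmulrn gez0_abs // subr_ge0.
have F0 n : (n.+1%:R : {fraction {poly int}}) != 0.
  by rewrite -tofrac1 -tofracMn tofrac_eq0 -polyC_natr polyC_eq0 pnatr_eq0.
have u0 : t != 0 by rewrite tofrac_eq0 polyX_eq0.
have u_free n : (0 < n)%N -> t ^+ n != 1.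
  move=> n0; rewrite -tofracXn -tofrac1 tofrac_eq.
  apply/negP => /eqP /(congr1 (fun p : {poly int} => size p)).
  by rewrite size_polyXn size_poly1 => -[E]; rewrite E in n0.
(* With [u] the variable itself, this is the desired formula at its square. *)
have key := cominuscule_ideals hR F0 u0 comin e_inj e_coef e_surj leP u_free.
have htE q : ht Pi (val q) = ht_ co (e q).
  by rewrite ht_E; apply: eq_bigr => k _; rewrite coE.
have /fin_all_exists [n En] : forall q : Delta1 Delta Pi i, exists n : nat,
    (0 < n)%N /\ ht_ co (e q) = n%:Z.
  move=> q; have := ht_gt0 hR (pos_coef1 hR (e_coef q)).
  by case: (ht_ co _) => // n; exists n.
rewrite big_seq_fsetE /=.
rewrite (eq_bigr (fun q => (1 - t ^+ (n q).+1) / (1 - t ^+ n q))); last first.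
  by move=> q _; rewrite htE (En q).2 -PoszD addn1.
apply: tofrac_prod_sqr => [//|q|]; first exact: (En q).1.
have -> : tofrac (ideal_poly (@root_le R (hdual h) Delta r Pi i) \Po 'X^2) =
    \sum_(I | upper_ideal (@root_le R (hdual h) Delta r Pi i) I) (t ^+ 2) ^+ #|I|.
  rewrite /ideal_poly linear_sum rmorph_sum; apply: eq_bigr => I _ /=.
  by rewrite comp_Xn_poly !tofracXn.
rewrite key; apply: eq_bigr => q _.
by rewrite (En q).2 -PoszD addn1.
Qed.
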